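(* Fix $\beta>0$ and $p\in(1,\infty)$. For $\theta\in(0,1]$ and $L>0$ define the $L$-periodic step function $b_{\theta,L}$ by $$b_{\theta,L}(x):=b_\theta(x/L),\qquad b_\theta(x):=\beta^{1/p}\sum_{k\in\mathbb{Z}}\theta^{-1/p}\chi_{I_k}(x),\qquad I_k:=k+[0,\theta],$$ where $\chi_I$ is the characteristic function of $I$. For each $L>0$ choose $\theta(L)\in(0,1]$ such that $c^*(b_{\theta(L),L})=\max_{\theta\in(0,1]}c^*(b_{\theta,L})$. Then $$\theta(L)\to0\quad\text{and}\quad c^*(b_{\theta(L),L})\to\infty\qquad\text{as } L\to\infty.$$
   Context: For $\lambda\in\mathbb{R}$ and a real $L$-periodic function $b\in L^1_{\rm loc}(\mathbb{R})$, $k(\lambda,b)\in\mathbb{R}$ denotes the principal eigenvalue of $-L_{\lambda,b}\psi:=-\psi''-2\lambda\psi'-(b(x)+\lambda^2)\psi$ on $\mathbb{R}/L\mathbb{Z}$, i.e. the unique real number for which $-L_{\lambda,b}\psi=k(\lambda,b)\psi$ has an $L$-periodic positive solution $\psi$. For $b\ge0$, $b\not\equiv0$, the minimal speed of pulsating traveling waves of $u_t=u_{xx}+b(x)(1-u)u$ is $c^*(b)=\min_{\lambda>0}\frac{-k(\lambda,b)}{\lambda}$. *)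

(* Defs.v *)
From HB Require Import structures.
From mathcomp Require Import all_boot all_order all_algebra.
From mathcomp Require Import all_classical all_reals all_analysis.

Set Implicit Arguments.
Unset Strict Implicit.
Unset Printing Implicit Defensive.
Import Order.TTheory GRing.Theory Num.Theory.
Import numFieldNormedType.Exports.

Local Open Scope classical_set_scope.
Local Open Scope ring_scope.

(* [g] is in W^{1,1}_loc(R), i.e. locally absolutely continuous (everywhere,
   not up to a null set), with derivative [h] in L^1_loc(R). *)
Definition has_L1loc_derivative (R : realType) (g h : R -> R) : Prop :=
  locally_integrable setT h /\
  forall x y : R, x <= y ->
    g y - g x = \int[@lebesgue_measure R]_(t in `[x, y]) h t.

(* As [b] is only in L^1_loc, solutions of
     - psi'' - 2 lambda psi' - (b + lambda^2) psi = k psi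
   are taken in W^{2,1}_loc: psi is differentiable everywhere, psi' is locally
   absolutely continuous with derivative [psi2], and the equation holds almost
   everywhere.  When b is piecewise continuous such psi are C^1 and satisfy the
   equation classically away from the discontinuities of b. *)
Definition eigen_solution (R : realType) (lambda : R) (b : R -> R) (k : R)
    (psi : R -> R) : Prop :=
  (forall x, derivable psi x 1) /\
  exists psi2 : R -> R,
    has_L1loc_derivative (derive1 psi : R -> R) psi2 /\
    {ae @lebesgue_measure R, forall x,
      - psi2 x - 2 * lambda * derive1 psi x - (b x + lambda ^+ 2) * psi x
        = k * psi x}.

Definition is_principal_eigenvalue (R : realType) (L lambda : R) (b : R -> R)
    (k : R) : Prop :=
  exists psi : R -> R,
    [/\ periodic psi L, forall x, 0 < psi x & eigen_solution lambda b k psi].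

(* [get A] is an element of [A], when there is one (and 0 otherwise); for
   [L > 0] and [b] an L-periodic function in L^1_loc the set is a singleton. *)
Definition principal_eigenvalue (R : realType) (L lambda : R) (b : R -> R) : R :=
  get [set k | is_principal_eigenvalue L lambda b k].

(* The least element of [A] if there is one, 0 otherwise. *)
Definition set_min (R : realType) (A : set R) : R := get (A `&` lbound A).

Definition minimal_speed (R : realType) (L : R) (b : R -> R) : R :=
  set_min [set - principal_eigenvalue L lambda b / lambda
          | lambda in [set lambda : R | 0 < lambda]].

(* For 0 < theta <= 1 the sum has finite support at each x: the closed intervals
   meet at most two by two, and only when theta = 1, at the integers. *)
Definition step_profile (R : realType) (beta p theta : R) (x : R) : R :=
  beta `^ p^-1 *
  \sum_(k \in [set: int])
     theta `^ (- p^-1) * \1_(`[k%:~R, k%:~R + theta] : set R) x.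

Definition step_function (R : realType) (beta p theta L : R) (x : R) : R :=
  step_profile beta p theta (x / L).

(* Main.v *)
Require Import Defs.
From HB Require Import structures.
From mathcomp Require Import all_boot all_order all_algebra.
From mathcomp Require Import all_classical all_reals all_analysis.
From mathcomp Require Import measurable_realfun.
From mathcomp Require Import ring lra.
Import Order.TTheory GRing.Theory Num.Theory.
Import numFieldNormedType.Exports.
Local Open Scope classical_set_scope.
Local Open Scope ring_scope.

(** Write [mu = - k] and [phi x = exp (lambda x) psi x]: an eigenfunction is a
   positive solution of [phi'' = (mu - b) phi] that is multiplied by
   [exp (lambda L)] over a period.  Put [a = theta L] and let [h] be the height
   of the step.  Integrating the equations of [psi] and of [phi' / phi] over a
   period gives [lambda^2 <= mu <= lambda^2 + h].  In particular, taking
   [lambda = 1], the minimal speed is at most [1 + h].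

   Assume [h > (pi / a)^2].  Solving explicitly on the two pieces, the existence
   of [phi] becomes a scalar equation in [(lambda, mu)], which by the intermediate
   value theorem has for each [lambda] a root [mu >= h - (pi / a)^2]; Wronskians
   show that [mu] is unique.  With [mu >= lambda^2] this gives
   [mu / lambda >= sqrt (h - (pi / a)^2)].  The minimum over [lambda] is attained
   because the set of solutions [(lambda, mu)] is closed and [mu / lambda] is
   large both for small and for large [lambda].

   For a fixed small [theta], [h] is large and [pi / a -> 0] as [L -> oo], so the
   maximal speeds tend to infinity.  By the upper bound the heights at [theta L]
   tend to infinity too, that is, [theta L -> 0]. *)

Set Implicit Arguments.
Unset Strict Implicit.
Unset Printing Implicit Defensive.

(** * Derivatives and monotonicity *)

Section RealDerivatives.
Variable R : realType.
Implicit Types (f g df : R -> R) (x y u v c : R).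

Lemma is_derive_cast {f x a b} : is_derive x 1 f a -> a = b -> is_derive x 1 f b.
Proof. by move=> + <-. Qed.

Lemma is_derive_add {f g x a b} : is_derive x 1 f a -> is_derive x 1 g b ->
  is_derive x 1 (fun y => f y + g y) (a + b).
Proof. by move=> ? ?; exact: is_deriveD. Qed.

Lemma is_derive_sub {f g x a b} : is_derive x 1 f a -> is_derive x 1 g b ->
  is_derive x 1 (fun y => f y - g y) (a - b).
Proof. by move=> ? ?; exact: is_deriveB. Qed.

Lemma is_derive_mul {f g x a b} : is_derive x 1 f a -> is_derive x 1 g b ->
  is_derive x 1 (fun y => f y * g y) (f x * b + g x * a).
Proof. by move=> ? ?; exact: is_deriveM. Qed.

Lemma is_derive_scale {f x a} c : is_derive x 1 f a ->
  is_derive x 1 (fun y => c * f y) (c * a).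
Proof. by move=> ?; exact: is_deriveZ. Qed.

Lemma is_derive_inv {f x a} : f x != 0 -> is_derive x 1 f a ->
  is_derive x 1 (fun y => (f y)^-1) (- (f x) ^- 2 * a).
Proof. by move=> ? ?; exact: is_deriveV. Qed.

Lemma is_derive_continuous {f df} : (forall x, is_derive x 1 f (df x)) ->
  continuous f.
Proof.
move=> dF x; apply: differentiable_continuous; apply/derivable1_diffP.
by have [] := dF x.
Qed.

Lemma continuous_add f g : continuous f -> continuous g ->
  continuous (fun x => f x + g x).
Proof. by move=> cf cg x; apply: (continuousD (cf x) (cg x)). Qed.

Lemma continuous_sub f g : continuous f -> continuous g ->
  continuous (fun x => f x - g x).
Proof. by move=> cf cg x; apply: (continuousB (cf x) (cg x)). Qed.

Lemma continuous_mul f g : continuous f -> continuous g ->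
  continuous (fun x => f x * g x).
Proof. by move=> cf cg x; apply: (continuousM (cf x) (cg x)). Qed.

Lemma continuous_scale c f : continuous f -> continuous (fun x => c * f x).
Proof. by move=> cf; apply: continuous_mul => //; exact: cst_continuous. Qed.

Lemma is_derive_scaled_arg {f x a} c : is_derive (c * x) 1 f a ->
  is_derive x 1 (fun y => f (c * y)) (c * a).
Proof.
move=> df; have dc : is_derive x 1 (fun y => c * y) (c * 1).
  exact: (is_derive_scale c (is_derive_id x 1)).
by apply: (is_derive_cast (is_derive1_comp df dc)); rewrite mulr1 mulrC.
Qed.

Lemma is_derive_shifted_arg {f x a} c : is_derive (x - c) 1 f a ->
  is_derive x 1 (fun y => f (y - c)) a.
Proof.
move=> df; have dc : is_derive x 1 (fun y => y - c) (1 - 0).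
  exact: (is_derive_sub (is_derive_id x 1) (is_derive_cst c x 1)).
apply: (is_derive_cast (@is_derive1_comp R f (fun y => y - c) x a _ df dc)).
by rewrite subr0 mulr1.
Qed.

Lemma is_derive_reflected_arg {f x a} c : is_derive (c - x) 1 f a ->
  is_derive x 1 (fun y => f (c - y)) (- a).
Proof.
move=> df; have dc : is_derive x 1 (fun y => c - y) (0 - 1).
  exact: (is_derive_sub (is_derive_cst c x 1) (is_derive_id x 1)).
apply: (is_derive_cast (@is_derive1_comp R f (fun y => c - y) x a _ df dc)).
by rewrite sub0r mulrN1.
Qed.

Lemma is_derive_expR_scale c x :
  is_derive x 1 (fun y => expR (c * y)) (c * expR (c * x)).
Proof. exact: is_derive_scaled_arg. Qed.

Lemma mvt_continuous f df u v : u < v -> continuous f ->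
  (forall x, u < x < v -> is_derive x 1 f (df x)) ->
  exists2 c, u < c < v & f v - f u = df c * (v - u).
Proof.
move=> uv cf dF.
have dF' x : x \in `]u, v[ -> is_derive x 1 f (df x) by rewrite in_itv; exact: dF.
have [c + E] := MVT uv dF' (continuous_subspaceT cf).
by rewrite in_itv => cuv; exists c.
Qed.

Lemma le0_derive_le f df u v : u <= v -> continuous f ->
  (forall x, u < x < v -> is_derive x 1 f (df x) /\ df x <= 0) -> f v <= f u.
Proof.
rewrite le_eqVlt => /predU1P[->//|uv] cf dF.
have [x /dF[]//|c /dF[_ dc] +] := mvt_continuous uv cf (df := df).
by move=> E; rewrite -subr_le0 E mulr_le0_ge0 // subr_ge0 ltW.
Qed.

Lemma gt0_derive_lt f df u v : u < v -> continuous f ->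
  (forall x, u < x < v -> is_derive x 1 f (df x) /\ 0 < df x) -> f u < f v.
Proof.
move=> uv cf dF.
have [x /dF[]//|c /dF[_ dc] E] := mvt_continuous uv cf (df := df).
by rewrite -subr_gt0 E mulr_gt0 // subr_gt0.
Qed.

Lemma gt0_derive_le f df u v : u <= v -> continuous f ->
  (forall x, u < x < v -> is_derive x 1 f (df x) /\ 0 < df x) -> f u <= f v.
Proof.
by rewrite le_eqVlt => /predU1P[->//|uv] cf dF; apply/ltW/(gt0_derive_lt uv cf dF).
Qed.

End RealDerivatives.

(** * Floquet solutions: bounds and uniqueness *)

Section FloquetBounds.
Variable R : realType.
Implicit Types (lambda mu h a L : R) (f g : R -> R).

(* With [phi := exp (lambda x) psi] and [mu := - k] the eigenvalue equation
   becomes [phi'' = (mu - b) phi] and periodicity becomes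
   [phi (x + L) = exp (lambda L) phi x]; here [f] is [phi] and [g] is [phi'],
   over the single period [0, L]. *)
Definition floquet_solution lambda mu h a L f g : Prop :=
  [/\ forall x, 0 < f x, forall x : R, is_derive x 1 f (g x) & continuous g] /\
  [/\ forall x : R, 0 < x < a -> is_derive x 1 g ((mu - h) * f x),
      forall x : R, a < x < L -> is_derive x 1 g (mu * f x),
      f L = expR (lambda * L) * f 0 & g L = expR (lambda * L) * g 0].

(** With [psi = exp (- lambda x) f], the function [G] of the proof is [psi' + 2 lambda psi]. It is
    periodic with derivative [(mu - b - lambda ^+ 2) psi], so a larger [mu] would make it strictly
    increasing. *)
Lemma floquet_upper_bound lambda mu h a L f g :
  0 < a <= L -> 0 <= h -> floquet_solution lambda mu h a L f g ->
  mu <= lambda ^+ 2 + h.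
Proof.
move=> /andP[a0 aL] h0 [[f0 df cg] [dg1 dg2 fL gL]].
rewrite leNgt; apply/negP => mulh.
pose G x := expR (- lambda * x) * (g x + lambda * f x).
have cf := is_derive_continuous df.
have cG : continuous G.
  apply: continuous_mul; first exact: (is_derive_continuous (is_derive_expR_scale _)).
  by apply: continuous_add => //; exact: continuous_scale.
have dG (x q : R) : is_derive x 1 g (q * f x) ->
    is_derive x 1 G (expR (- lambda * x) * ((q - lambda ^+ 2) * f x)).
  move=> dg; apply: (is_derive_cast (is_derive_mul (is_derive_expR_scale (- lambda) x)
      (is_derive_add dg (is_derive_scale lambda (df x))))).
  by ring.
have e0 x : 0 < expR (- lambda * x) by exact: expR_gt0.
have G1 : G 0 < G a.
  apply: (gt0_derive_lt
    (df := fun x => expR (- lambda * x) * ((mu - h - lambda ^+ 2) * f x))) => //.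
  move=> x /dg1/dG; split=> //; rewrite !mulr_gt0 //; lra.
have G2 : G a <= G L.
  apply: (gt0_derive_le
    (df := fun x => expR (- lambda * x) * ((mu - lambda ^+ 2) * f x))) => //.
  move=> x /dg2/dG; split=> //; rewrite !mulr_gt0 //; lra.
have : G L = G 0.
  rewrite /G fL gL mulr0 expR0 mul1r mulrCA -mulrDr mulrA -expRD.
  by rewrite mulNr addNr expR0 mul1r.
lra.
Qed.

Lemma floquet_lower_bound lambda mu h a L f g :
  0 < a <= L -> 0 <= h -> floquet_solution lambda mu h a L f g ->
  lambda ^+ 2 <= mu.
Proof.
move=> /andP[a0 aL] h0 [[f0 df cg] [dg1 dg2 fL gL]].
have cf := is_derive_continuous df.
(* Since [(g / f)' = mu - b - (g / f)^2], this has derivative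
   [- b - (g / f - lambda)^2]. *)
pose G x := g x * (f x)^-1 + 2 * lambda * ln (f x) - (mu + lambda ^+ 2) * x.
have fn0 x : f x != 0 by rewrite gt_eqF.
have dlnf (x : R) : is_derive x 1 (fun y => ln (f y)) ((f x)^-1 * g x).
  exact: (is_derive1_comp (is_derive1_ln (f0 x)) (df x)).
have dx (x : R) := is_derive_scale (mu + lambda ^+ 2) (is_derive_id x (1 : R)).
have cG : continuous G.
  apply: continuous_sub; last exact: is_derive_continuous dx.
  apply: continuous_add; last exact: continuous_scale (is_derive_continuous dlnf).
  by apply: continuous_mul => // x; apply: (continuousV (fn0 x) (cf x)).
have dG (x q : R) : is_derive x 1 g ((mu - q) * f x) ->
    is_derive x 1 G (- q - (g x / f x - lambda) ^+ 2).
  move=> dg; apply: (is_derive_cast (is_derive_sub (is_derive_add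
      (is_derive_mul dg (is_derive_inv (fn0 x) (df x)))
      (is_derive_scale (2 * lambda) (dlnf x))) (dx x))).
  by field; exact: fn0.
have G1 : G a <= G 0.
  apply: (le0_derive_le (df := fun x => - h - (g x / f x - lambda) ^+ 2)) => //.
    exact: ltW.
  by move=> x /dg1/dG; split=> //; have := sqr_ge0 (g x / f x - lambda); lra.
have G2 : G L <= G a.
  apply: (le0_derive_le (df := fun x => - 0 - (g x / f x - lambda) ^+ 2)) => //.
  move=> x /dg2 dg; split=> //; first by apply: dG; rewrite subr0.
  by have := sqr_ge0 (g x / f x - lambda); lra.
(* The multiplier [exp (lambda L)] cancels in [g / f] and adds [lambda * L] to [ln f], so the
   increment is [2 lambda ^+ 2 L - (mu + lambda ^+ 2) L]. *)
have : G L = G 0 + (lambda ^+ 2 - mu) * L.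
  rewrite /G fL gL lnM ?posrE ?expR_gt0 // expRK.
  have en0 : expR (lambda * L) != 0 by rewrite gt_eqF ?expR_gt0.
  by field; rewrite en0 fn0.
have L0 : 0 < L by lra.
move=> E; have : (lambda ^+ 2 - mu) * L <= 0 by lra.
by rewrite pmulr_lle0 // subr_le0.
Qed.

(** As [mu2 < mu1], the Wronskian increases; being multiplied by [exp (2 lambda L) > 1] over a
    period, it is positive from the start. Then [f1 / f2] increases strictly, although the two
    multipliers cancel in it. *)
Lemma floquet_wronskian lambda mu1 mu2 h a L f1 g1 f2 g2 :
  0 < lambda -> 0 < a <= L -> mu2 < mu1 ->
  floquet_solution lambda mu1 h a L f1 g1 ->
  floquet_solution lambda mu2 h a L f2 g2 -> False.
Proof.
move=> lambda0 /andP[a0 aL] mu12.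
move=> [[f10 df1 cg1] [dg11 dg12 f1L g1L]] [[f20 df2 cg2] [dg21 dg22 f2L g2L]].
have cf1 := is_derive_continuous df1; have cf2 := is_derive_continuous df2.
pose W x := g1 x * f2 x - f1 x * g2 x.
have cW : continuous W.
  by apply: continuous_sub; exact: continuous_mul.
have dW (x q : R) : is_derive x 1 g1 ((mu1 - q) * f1 x) ->
    is_derive x 1 g2 ((mu2 - q) * f2 x) ->
    is_derive x 1 W ((mu1 - mu2) * (f1 x * f2 x)) /\
      0 < (mu1 - mu2) * (f1 x * f2 x).
  move=> d1 d2; split; last by rewrite !mulr_gt0 // subr_gt0.
  apply: (is_derive_cast (is_derive_sub (is_derive_mul d1 (df2 x))
    (is_derive_mul (df1 x) d2))).
  by ring.
have dW1 x : 0 < x < a -> is_derive x 1 W ((mu1 - mu2) * (f1 x * f2 x)) /\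
      0 < (mu1 - mu2) * (f1 x * f2 x).
  by move=> xa; apply: (dW x h); [exact: dg11|exact: dg21].
have dW2 x : a < x < L -> is_derive x 1 W ((mu1 - mu2) * (f1 x * f2 x)) /\
      0 < (mu1 - mu2) * (f1 x * f2 x).
  by move=> xa; apply: (dW x 0); rewrite subr0; [exact: dg12|exact: dg22].
have W0a : W 0 < W a by apply: gt0_derive_lt => //; exact: dW1.
have WaL : W a <= W L by apply: gt0_derive_le => //; exact: dW2.
have W0 : 0 < W 0.
  have : W L = expR (lambda * L) ^+ 2 * W 0 by rewrite /W f1L f2L g1L g2L; ring.
  have e1 : 1 < expR (lambda * L) by rewrite expR_gt1 mulr_gt0 //; lra.
  have e2 : 1 < expR (lambda * L) ^+ 2 by rewrite exprn_egt1.
  move=> E; have : 0 < (expR (lambda * L) ^+ 2 - 1) * W 0 by lra.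
  by rewrite pmulr_rgt0 // subr_gt0.
have Wx x : 0 < x < L -> 0 < W x.
  move=> /andP[x0 xL]; apply: (lt_le_trans W0).
  have [xa|ax] := leP x a.
    apply: gt0_derive_le => //; first exact: ltW.
    by move=> y /andP[y0 yx]; apply: dW1; rewrite y0 (lt_le_trans yx).
  apply: (le_trans (ltW W0a)); apply: gt0_derive_le => //; first exact: ltW.
  by move=> y /andP[ay yx]; apply: dW2; rewrite ay (lt_trans yx).
have f2n0 x : f2 x != 0 by rewrite gt_eqF.
pose r x := f1 x * (f2 x)^-1.
have dr (x : R) : is_derive x 1 r (W x * (f2 x) ^- 2).
  apply: (is_derive_cast (is_derive_mul (df1 x) (is_derive_inv (f2n0 x) (df2 x)))).
  by rewrite /W; field.
have : r 0 < r L.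
  apply: (gt0_derive_lt (df := fun x => W x * (f2 x) ^- 2)).
  - by lra.
  - exact: is_derive_continuous dr.
  - by move=> x xL; split=> //; rewrite mulr_gt0 ?Wx // invr_gt0 exprn_gt0.
rewrite /r f1L f2L invfM mulrACA divff ?mul1r ?ltxx //.
by rewrite gt_eqF ?expR_gt0.
Qed.

End FloquetBounds.

(** * Eigenfunctions as classical solutions *)

Section EigenSolutionsAreClassical.
Variable R : realType.
Notation mu := (@lebesgue_measure R).
Implicit Types (f g : R -> R) (x y u v c lambda k h a L : R).

Lemma locally_integrable_itv f u v : locally_integrable setT f ->
  mu.-integrable `[u, v] (EFin \o f).
Proof.
move=> [mf _ intf]; apply/integrableP; split.
  by apply/measurable_EFinP; apply: measurable_funS mf.
by apply: intf => //; exact: segment_compact.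
Qed.

Lemma Rintegral_itv_cat f u v w : u <= v <= w ->
  mu.-integrable `[u, w] (EFin \o f) ->
  \int[mu]_(t in `[u, w]) f t =
    \int[mu]_(t in `[u, v]) f t + \int[mu]_(t in `[v, w]) f t.
Proof.
move=> /andP[uv vw] intf.
have := Rintegral_itvB intf (x := v); rewrite !bnd_simp => /(_ uv vw) E.
rewrite -(Rintegral_itv_obnd_cbnd (r := v)); last first.
  by apply: integrableS intf => //; apply: subset_itvr; rewrite bnd_simp.
by rewrite -E addrC subrK.
Qed.

Lemma has_L1loc_derivative_continuous f g :
  has_L1loc_derivative f g -> continuous f.
Proof.
move=> [lg fE] x.
have x1 : x - 1 <= x + 1 by lra.
have cint := parameterized_integral_continuous x1 (locally_integrable_itv _ _ lg).
have xin : x \in `]x - 1, x + 1[ by rewrite in_itv /=; lra.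
have x1' : x - 1 < x + 1 by lra.
have [/(_ _ xin) cI _ _] := (continuous_within_itvP _ x1').1 cint.
have Nx := near_in_itvoo xin.
have nE : \forall y \near x, f (x - 1) + parameterized_integral mu (x - 1) y g = f y.
  near=> y; rewrite /parameterized_integral -fE; first by rewrite addrC subrK.
  have : y \in `]x - 1, x + 1[ by near: y.
  by rewrite in_itv => /andP[/ltW].
have : {for x, continuous (fun y => f (x - 1) + parameterized_integral mu (x - 1) y g)}.
  by apply: (continuousD (@cst_continuous _ _ (f (x - 1)) x) cI).
rewrite /prop_for /continuous_at (nbhs_singleton nE).
by apply: cvg_trans; apply: near_eq_cvg.
Unshelve. all: by end_near. Qed.

(** Altering the integrand on a null set keeps the integral, so on []u, v[] the function [f] is an
    indefinite integral of the continuous [F], and the fundamental theorem of calculus applies at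
    every point. *)
Lemma has_L1loc_derivative_is_derive f g F u v : has_L1loc_derivative f g ->
  continuous F ->
  {ae mu, forall x, u < x < v -> g x = F x} ->
  forall x, u < x < v -> is_derive x 1 f (F x).
Proof.
move=> [lg fE] cF gF x /andP[ux xv].
have intF w z : mu.-integrable `[w, z] (EFin \o F).
  apply: continuous_compact_integrable; first exact: segment_compact.
  exact: continuous_subspaceT.
have intE y : u <= y <= v -> f y = f u + \int[mu]_(t in `[u, y]) F t.
  move=> /andP[uy yv].
  have := fE u y uy.
  have [mg _ _] := lg.
  have mF : measurable_fun setT F by exact: continuous_measurable_fun.
  have -> : \int[mu]_(t in `[u, y]) g t = \int[mu]_(t in `[u, y]) F t.
    (* The identity [g = F] is given inside []u, v[] only, so the endpoints are first removed from
       the domain of integration. *)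
    rewrite /Rintegral integral_itv_bndoo; last first.
      by apply/measurable_EFinP; apply: measurable_funS mg.
    rewrite (integral_itv_bndoo (f := EFin \o F)); last first.
      by apply/measurable_EFinP; apply: measurable_funS mF.
    congr fine; apply: ae_eq_integral => //.
    - by apply/measurable_EFinP; apply: measurable_funS mg.
    - by apply/measurable_EFinP; apply: measurable_funS mF.
    - apply: filterS gF; first exact: (ae_filter_ringOfSetsType mu).
      move=> t gFt; rewrite /= in_itv /= => /andP[ut ty].
      by congr EFin; apply: gFt; rewrite ut (lt_le_trans ty).
  by move=> <-; rewrite addrC subrK.
have [dG GE] := continuous_FTC1_closed xv (intF u v) ux (cF x).
set G := fun y => \int[mu]_(t in `[u, y]) F t in dG GE.
have dfG : is_derive x 1 (fun y => f u + G y) (0 + F x).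
  apply: (is_derive_add (is_derive_cst (f u) x 1)).
  by split => //; rewrite -derive1E.
apply: (near_eq_is_derive (f := fun y => f u + G y)); last by rewrite -[F x]add0r.
have xin : x \in `]u, v[ by rewrite in_itv /= ux.
have Nx := near_in_itvoo xin.
near=> y; rewrite -intE //.
have : y \in `]u, v[ by near: y.
by rewrite in_itv => /andP[/ltW -> /ltW ->].
Unshelve. all: by end_near. Qed.

(** Passes from the weak equation to the classical one: [b] is constant on each open piece, so
    [psi''] coincides there, almost everywhere, with a continuous expression in [psi] and [psi']. *)
Lemma eigen_floquet L lambda b k h a :
  is_principal_eigenvalue L lambda b k ->
  (forall x, 0 < x < a -> b x = h) -> (forall x, a < x < L -> b x = 0) ->
  exists f g, floquet_solution lambda (- k) h a L f g.
Proof.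
move=> [psi [psiL psi0 [dpsi [psi2 [dpsi1 eqn]]]]] b1 b2.
have c1 := has_L1loc_derivative_continuous dpsi1.
have dpsi' (x : R) : is_derive x 1 psi (derive1 psi x).
  by split; [exact: dpsi|rewrite derive1E].
have c0 := is_derive_continuous dpsi'.
(* The value of [psi''] dictated by the equation where [b = c]. *)
pose F c x := - (2 * lambda) * derive1 psi x - (c + lambda ^+ 2 + k) * psi x.
have cF c : continuous (F c).
  apply: continuous_sub; last exact: continuous_scale.
  exact: continuous_scale.
have dpsi2 u v c : (forall x, u < x < v -> b x = c) ->
    forall x, u < x < v -> is_derive x 1 (derive1 psi) (F c x).
  move=> bc; apply: (has_L1loc_derivative_is_derive dpsi1 (cF c)).
  apply: filterS eqn; first exact: (ae_filter_ringOfSetsType mu).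
  by move=> x E /bc bx; move: E; rewrite bx /F; lra.
have psi1L : derive1 psi L = derive1 psi 0.
  have psiE : psi = fun y => psi (y - - L).
    by apply/funext => y; rewrite opprK psiL.
  rewrite [in RHS]derive1E; apply/esym/derive_val.
  rewrite [in X in is_derive _ _ X]psiE; apply: is_derive_shifted_arg.
  by rewrite opprK add0r; exact: dpsi'.
have dE := is_derive_expR_scale lambda.
exists (fun x => expR (lambda * x) * psi x),
  (fun x => expR (lambda * x) * (derive1 psi x + lambda * psi x)).
have dg (x c : R) : is_derive x 1 (derive1 psi) (F c x) ->
    is_derive x 1 (fun x => expR (lambda * x) * (derive1 psi x + lambda * psi x))
      ((- k - c) * (expR (lambda * x) * psi x)).
  move=> d2; apply: (is_derive_cast (is_derive_mul (dE x)
    (is_derive_add d2 (is_derive_scale lambda (dpsi' x))))).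
  by rewrite /F; ring.
split; split.
- by move=> x; rewrite mulr_gt0 // expR_gt0.
- move=> x; apply: (is_derive_cast (is_derive_mul (dE x) (dpsi' x))).
  by ring.
- apply: continuous_mul; first exact: is_derive_continuous dE.
  by apply: continuous_add => //; exact: continuous_scale.
- by move=> x xa; apply: dg; exact: dpsi2 b1 _ xa.
- by move=> x xa; rewrite -[- k]subr0; apply: dg; exact: dpsi2 b2 _ xa.
- by rewrite mulr0 expR0 mul1r -(psiL 0) add0r.
- by rewrite mulr0 expR0 mul1r psi1L -(psiL 0) add0r.
Qed.

End EigenSolutionsAreClassical.

(** * Fundamental solutions of y'' = q y *)

Section FundamentalSolutions.
Variable R : realType.
Implicit Types (q x y a d : R).

Definition cosh x : R := (expR x + expR (- x)) / 2.
Definition sinh x : R := (expR x - expR (- x)) / 2.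

Lemma is_derive_expRN x : is_derive x 1 (fun y => expR (- y)) (- expR (- x)).
Proof.
have -> : (fun y => expR (- y)) = (fun y => expR (-1 * y)).
  by apply/funext => y; rewrite mulN1r.
by apply: (is_derive_cast (is_derive_expR_scale (-1) x)); rewrite !mulN1r.
Qed.

Lemma is_derive_cosh x : is_derive x 1 cosh (sinh x).
Proof.
have -> : cosh = fun y => 2^-1 * (expR y + expR (- y)).
  by apply/funext => y; rewrite /cosh mulrC.
apply: (is_derive_cast (is_derive_scale 2^-1
  (is_derive_add (is_derive_expR x) (is_derive_expRN x)))).
by rewrite /sinh mulrC.
Qed.

Lemma is_derive_sinh x : is_derive x 1 sinh (cosh x).
Proof.
have -> : sinh = fun y => 2^-1 * (expR y - expR (- y)).
  by apply/funext => y; rewrite /sinh mulrC.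
apply: (is_derive_cast (is_derive_scale 2^-1
  (is_derive_sub (is_derive_expR x) (is_derive_expRN x)))).
by rewrite /cosh opprK mulrC.
Qed.

Lemma cosh0 : cosh 0 = 1.
Proof. by rewrite /cosh oppr0 expR0; field. Qed.

Lemma sinh0 : sinh 0 = 0.
Proof. by rewrite /sinh oppr0 subrr mul0r. Qed.

Lemma cosh2Bsinh2 x : cosh x ^+ 2 - sinh x ^+ 2 = 1.
Proof.
have e : expR x * expR (- x) = 1 by rewrite -expRD subrr expR0.
by rewrite -[RHS]e /cosh /sinh; field.
Qed.

Lemma cosh_gt0 x : 0 < cosh x.
Proof. by rewrite divr_gt0 // addr_gt0 // expR_gt0. Qed.

Lemma sinh_gt0 x : 0 < x -> 0 < sinh x.
Proof. by move=> x0; rewrite divr_gt0 // subr_gt0 ltr_expR; lra. Qed.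

Lemma coshD x y : cosh (x + y) = cosh x * cosh y + sinh x * sinh y.
Proof. by rewrite /cosh /sinh opprD !expRD; field. Qed.

Lemma continuous_cosh : continuous cosh.
Proof. exact: is_derive_continuous is_derive_cosh. Qed.

Lemma ler_cosh x y : 0 <= x -> x <= y -> cosh x <= cosh y.
Proof.
move=> x0 xy; apply: (gt0_derive_le (df := sinh)) => //; first exact: continuous_cosh.
move=> z /andP[xz _]; split; first exact: is_derive_cosh.
by apply: sinh_gt0; lra.
Qed.

(** Fills the removable singularity of [f x / x] at 0 when [l] is the derivative there; this lets
    [sinh (s x) / s] and [sin (s x) / s] pass continuously through [s = 0]. *)
Definition slope0 (f : R -> R) (l x : R) : R := if x == 0 then l else f x / x.

Lemma continuous_slope0 (f : R -> R) (l : R) : f 0 = 0 ->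
  is_derive (0 : R) 1 f l -> continuous f -> continuous (slope0 f l).
Proof.
move=> f0 /is_derive1_caratheodory[g [fE cg gl]] cf.
have sE : slope0 f l = g.
  apply/funext => x; rewrite /slope0; have [->|x0] := eqVneq x 0; first by rewrite gl.
  by have := fE x; rewrite f0 !subr0 => ->; rewrite mulfK.
move=> x; have [->|x0] := eqVneq x 0; first by rewrite sE.
have nE : \forall y \near x, f y * y^-1 = slope0 f l y.
  near=> y; rewrite /slope0 ifN //; near: y.
  by apply: (open_nbhs_nbhs (A := [set y | y != 0])); split; first exact: open_neq.
have : {for x, continuous (fun y => f y * y^-1)}.
  by apply: (continuousM (cf x)); apply: (continuousV x0).
rewrite /prop_for /continuous_at.
have -> : f x * x^-1 = slope0 f l x by rewrite /slope0 ifN.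
by apply: cvg_trans; apply: near_eq_cvg.
Unshelve. all: by end_near. Qed.

(* The solutions of [y'' = q y] with data (1, 0) and (0, 1) at 0.  Since
   [Num.sqrt] vanishes on negative numbers, one of the two factors is always
   trivial; the product form makes the dependence on [q] visibly continuous. *)
Definition fcos q x : R := cosh (Num.sqrt q * x) * cos (Num.sqrt (- q) * x).

Definition fsin q x : R :=
  x * (slope0 sinh 1 (Num.sqrt q * x) * slope0 sin 1 (Num.sqrt (- q) * x)).

Lemma slope0_scale (f : R -> R) (l s x : R) : f 0 = 0 -> s != 0 ->
  x * slope0 f l (s * x) = s^-1 * f (s * x).
Proof.
move=> f0 s0; rewrite /slope0 mulf_eq0 (negPf s0) /=.
have [->|x0] := eqVneq x 0; first by rewrite mul0r mulr0 f0 mulr0.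
by field; rewrite x0 s0.
Qed.

Lemma fcos_ge0E q x : 0 <= q -> fcos q x = cosh (Num.sqrt q * x).
Proof.
by move=> q0; rewrite /fcos (ler0_sqrtr (a := - q)) ?oppr_le0 // mul0r cos0 mulr1.
Qed.

Lemma fcos_le0E q x : q <= 0 -> fcos q x = cos (Num.sqrt (- q) * x).
Proof. by move=> q0; rewrite /fcos (ler0_sqrtr q0) mul0r cosh0 mul1r. Qed.

Lemma fsin_gt0E q x : 0 < q -> fsin q x = (Num.sqrt q)^-1 * sinh (Num.sqrt q * x).
Proof.
move=> q0; rewrite /fsin (ler0_sqrtr (a := - q)) ?oppr_le0 ?(ltW q0) // mul0r.
rewrite {2}/slope0 eqxx mulr1 slope0_scale ?sinh0 //.
by rewrite gt_eqF // sqrtr_gt0.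
Qed.

Lemma fsin_lt0E q x : q < 0 ->
  fsin q x = (Num.sqrt (- q))^-1 * sin (Num.sqrt (- q) * x).
Proof.
move=> q0; rewrite /fsin (ler0_sqrtr (ltW q0)) mul0r.
rewrite {1}/slope0 eqxx mul1r slope0_scale ?sin0 //.
by rewrite gt_eqF // sqrtr_gt0 oppr_gt0.
Qed.

Lemma fsin_0E x : fsin 0 x = x.
Proof. by rewrite /fsin oppr0 sqrtr0 mul0r /slope0 eqxx !mulr1. Qed.

Lemma fsin0 q : fsin q 0 = 0.
Proof. by rewrite /fsin mul0r. Qed.

Lemma fcos0 q : fcos q 0 = 1.
Proof. by rewrite /fcos !mulr0 cosh0 cos0 mulr1. Qed.

Lemma is_derive_fsin q x : is_derive x 1 (fsin q) (fcos q x).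
Proof.
have [q0|q0|->] := ltgtP q 0.
- have -> : fsin q = fun y => (Num.sqrt (- q))^-1 * sin (Num.sqrt (- q) * y).
    by apply/funext => y; rewrite fsin_lt0E.
  have s0 : Num.sqrt (- q) != 0 by rewrite gt_eqF // sqrtr_gt0 oppr_gt0.
  apply: (is_derive_cast (is_derive_scale _
    (is_derive_scaled_arg (is_derive_sin (Num.sqrt (- q) * x))))).
  by rewrite mulKf // fcos_le0E // ltW.
- have -> : fsin q = fun y => (Num.sqrt q)^-1 * sinh (Num.sqrt q * y).
    by apply/funext => y; rewrite fsin_gt0E.
  have s0 : Num.sqrt q != 0 by rewrite gt_eqF // sqrtr_gt0.
  apply: (is_derive_cast (is_derive_scale _
    (is_derive_scaled_arg (is_derive_sinh (Num.sqrt q * x))))).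
  by rewrite mulKf // fcos_ge0E // ltW.
- have -> : fsin 0 = id by apply/funext => y; rewrite fsin_0E.
  by rewrite fcos_ge0E // sqrtr0 mul0r cosh0; exact: is_derive_id.
Qed.

Lemma is_derive_fcos q x : is_derive x 1 (fcos q) (q * fsin q x).
Proof.
have [q0|q0|->] := ltgtP q 0.
- have -> : fcos q = fun y => cos (Num.sqrt (- q) * y).
    by apply/funext => y; rewrite fcos_le0E // ltW.
  have s0 : Num.sqrt (- q) != 0 by rewrite gt_eqF // sqrtr_gt0 oppr_gt0.
  have qE : q = - Num.sqrt (- q) ^+ 2 by rewrite sqr_sqrtr ?opprK // oppr_ge0 ltW.
  apply: (is_derive_cast (is_derive_scaled_arg (is_derive_cos (Num.sqrt (- q) * x)))).
  by rewrite fsin_lt0E // {3}qE; field.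
- have -> : fcos q = fun y => cosh (Num.sqrt q * y).
    by apply/funext => y; rewrite fcos_ge0E // ltW.
  have s0 : Num.sqrt q != 0 by rewrite gt_eqF // sqrtr_gt0.
  have qE : q = Num.sqrt q ^+ 2 by rewrite sqr_sqrtr // ltW.
  apply: (is_derive_cast (is_derive_scaled_arg (is_derive_cosh (Num.sqrt q * x)))).
  by rewrite fsin_gt0E // {3}qE; field.
- have -> : fcos 0 = fun=> 1.
    by apply/funext => y; rewrite fcos_ge0E // sqrtr0 mul0r cosh0.
  by rewrite mul0r; exact: is_derive_cst.
Qed.

(** The Wronskian of the two fundamental solutions, that is, the determinant of the transfer matrix,
    is constant. *)
Lemma fcos2Bfsin2 q x : fcos q x ^+ 2 - q * fsin q x ^+ 2 = 1.
Proof.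
have [q0|q0|->] := ltgtP q 0.
- have s0 : Num.sqrt (- q) != 0 by rewrite gt_eqF // sqrtr_gt0 oppr_gt0.
  have qE : q = - Num.sqrt (- q) ^+ 2 by rewrite sqr_sqrtr ?opprK // oppr_ge0 ltW.
  rewrite fsin_lt0E // fcos_le0E ?ltW // {2}qE -[RHS](cos2Dsin2 (Num.sqrt (- q) * x)).
  by field.
- have s0 : Num.sqrt q != 0 by rewrite gt_eqF // sqrtr_gt0.
  have qE : q = Num.sqrt q ^+ 2 by rewrite sqr_sqrtr // ltW.
  rewrite fsin_gt0E // fcos_ge0E ?ltW // {2}qE -[RHS](cosh2Bsinh2 (Num.sqrt q * x)).
  by field.
- by rewrite fcos_ge0E // sqrtr0 mul0r cosh0 mul0r expr1n subr0.
Qed.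

Lemma continuous_comp_sqrt_scale (F : R -> R) x : continuous F ->
  continuous (fun q => F (Num.sqrt q * x)).
Proof.
move=> cF q; apply: continuous_comp; last exact: cF.
apply: (continuousM _ (@cst_continuous _ _ x q)).
exact: sqrt_continuous.
Qed.

Lemma continuous_comp_sqrtN_scale (F : R -> R) x : continuous F ->
  continuous (fun q => F (Num.sqrt (- q) * x)).
Proof.
move=> cF q.
apply: (continuous_comp (f := -%R) (g := fun q => F (Num.sqrt q * x))).
  exact: opp_continuous.
exact: continuous_comp_sqrt_scale.
Qed.

Lemma continuous_fcos x : continuous (fun q => fcos q x).
Proof.
exact: (continuous_mul (continuous_comp_sqrt_scale (x := x) continuous_cosh)
  (continuous_comp_sqrtN_scale (x := x) (@continuous_cos R))).
Qed.

Lemma continuous_fsin x : continuous (fun q => fsin q x).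
Proof.
have cs1 : continuous (slope0 sinh 1).
  apply: continuous_slope0; first exact: sinh0.
    by apply: (is_derive_cast (is_derive_sinh 0)); exact: cosh0.
  exact: (is_derive_continuous is_derive_sinh).
have cs2 : continuous (slope0 (@sin R) 1).
  apply: continuous_slope0; first exact: sin0.
    by apply: (is_derive_cast (is_derive_sin 0)); exact: cos0.
  exact: continuous_sin.
exact: (continuous_scale (c := x) (continuous_mul
  (continuous_comp_sqrt_scale (x := x) cs1)
  (continuous_comp_sqrtN_scale (x := x) cs2))).
Qed.

(** For [q < 0] the first positive zero of [fsin q] is [pi / sqrt (- q)], which the hypothesis puts
    beyond [a]; for [q >= 0] there is no positive zero. *)
Lemma fsin_gt0 q a x : 0 < x <= a -> - (pi / a) ^+ 2 < q -> 0 < fsin q x.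
Proof.
move=> /andP[x0 xa] qa; have a0 : 0 < a by lra.
have [q0|q0|->] := ltgtP q 0; last by rewrite fsin_0E.
- have s0 : 0 < Num.sqrt (- q) by rewrite sqrtr_gt0 oppr_gt0.
  rewrite fsin_lt0E // mulr_gt0 ?invr_gt0 // sin_gt0_pi // mulr_gt0 //=.
  have spa : Num.sqrt (- q) < pi / a.
    rewrite -(@ltr_pXn2r _ 2%N) ?nnegrE ?sqrtr_ge0 ?divr_ge0 ?pi_ge0 ?(ltW a0) //.
    by rewrite sqr_sqrtr ?oppr_ge0 ?(ltW q0) //; lra.
  apply: (@le_lt_trans _ _ (Num.sqrt (- q) * a)); first by rewrite ler_pM2l.
  by rewrite -ltr_pdivlMr.
- have s0 : 0 < Num.sqrt q by rewrite sqrtr_gt0.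
  by rewrite fsin_gt0E // mulr_gt0 ?invr_gt0 // sinh_gt0 // mulr_gt0.
Qed.

Lemma sqrt_pi_div a : 0 < a -> Num.sqrt (- - (pi / a) ^+ 2) * a = pi :> R.
Proof.
move=> a0; rewrite opprK sqrtr_sqr ger0_norm ?divr_ge0 ?pi_ge0 ?(ltW a0) //.
by rewrite divfK // gt_eqF.
Qed.

(** At this critical [q] exactly half a sine wave fits into [[0, a]]. *)
Lemma fsin_pi a : 0 < a -> fsin (- (pi / a) ^+ 2) a = 0.
Proof.
move=> a0; rewrite fsin_lt0E ?sqrt_pi_div // ?sinpi ?mulr0 //.
by rewrite oppr_lt0 exprn_gt0 // divr_gt0 // pi_gt0.
Qed.

Lemma fcos_pi a : 0 < a -> fcos (- (pi / a) ^+ 2) a = - 1.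
Proof.
move=> a0; rewrite fcos_le0E ?sqrt_pi_div // ?cospi //.
by rewrite oppr_le0 sqr_ge0.
Qed.

End FundamentalSolutions.

(** * Floquet solutions: existence *)

Section FloquetExistence.
Variable R : realType.
Implicit Types (q x y a d l s t lambda mu h L u rho : R).

(** Solves [y'' = q y] with value [s] at 0 and [t] at [l], when [fsin q l] is nonzero. Prescribing
    end values instead of initial data makes positivity visible. *)
Definition dirichlet q l s t x : R :=
  (t * fsin q x + s * fsin q (l - x)) * (fsin q l)^-1.

Definition dirichlet' q l s t x : R :=
  (t * fcos q x - s * fcos q (l - x)) * (fsin q l)^-1.

Lemma is_derive_dirichlet q l s t x :
  is_derive x 1 (dirichlet q l s t) (dirichlet' q l s t x).
Proof.
apply: (is_derive_cast (is_derive_mul (is_derive_add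
  (is_derive_scale t (is_derive_fsin q x))
  (is_derive_scale s (is_derive_reflected_arg (is_derive_fsin q (l - x)))))
  (is_derive_cst (fsin q l)^-1 x 1))).
by rewrite /dirichlet' /cst /=; ring.
Qed.

Lemma is_derive_dirichlet' q l s t x :
  is_derive x 1 (dirichlet' q l s t) (q * dirichlet q l s t x).
Proof.
apply: (is_derive_cast (is_derive_mul (is_derive_sub
  (is_derive_scale t (is_derive_fcos q x))
  (is_derive_scale s (is_derive_reflected_arg (is_derive_fcos q (l - x)))))
  (is_derive_cst (fsin q l)^-1 x 1))).
by rewrite /dirichlet /cst /=; ring.
Qed.

Lemma dirichlet_gt0 q l s t x : - (pi / l) ^+ 2 < q -> 0 < l -> 0 < s -> 0 < t ->
  0 <= x <= l -> 0 < dirichlet q l s t x.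
Proof.
move=> ql l0 s0 t0 /andP[x0 xl].
have sl : 0 < fsin q l by apply: (fsin_gt0 (a := l)) => //; rewrite l0 lexx.
rewrite /dirichlet mulr_gt0 ?invr_gt0 //.
have [->|xn0] := eqVneq x 0; first by rewrite fsin0 subr0 mulr0 add0r mulr_gt0.
have sx : 0 < fsin q x by apply: (fsin_gt0 (a := l)) => //; lra.
have [->|xnl] := eqVneq x l; first by rewrite subrr fsin0 mulr0 addr0 mulr_gt0.
have slx : 0 < fsin q (l - x) by apply: (fsin_gt0 (a := l)) => //; lra.
by rewrite addr_gt0 // mulr_gt0.
Qed.

Lemma dirichlet_left q l s t : fsin q l != 0 -> dirichlet q l s t 0 = s.
Proof. by move=> ql; rewrite /dirichlet fsin0 subr0 mulr0 add0r mulfK. Qed.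

Lemma dirichlet_right q l s t : fsin q l != 0 -> dirichlet q l s t l = t.
Proof. by move=> ql; rewrite /dirichlet subrr fsin0 mulr0 addr0 mulfK. Qed.

(** The value at [L] of the solution that leaves 0 with value 0 and slope 1 and crosses both pieces:
    an off-diagonal entry of the monodromy matrix. *)
Definition joint_fsin h a L mu : R :=
  fcos (mu - h) a * fsin mu (L - a) + fcos mu (L - a) * fsin (mu - h) a.

(** Glue two Dirichlet solutions with values [1], [u], [rho = exp (lambda L)] at [0], [a], [L]. With
    [s1], [s2] the two [fsin] values and [Q] the value of [joint_fsin], matching slopes means
    [u Q = s2 + rho s1] and [rho Q = u (rho s2 + s1)]; eliminating [u] makes [Q ^+ 2] equal to this
    expression. *)
Definition floquet_disc h a L lambda mu : R :=
  fsin (mu - h) a ^+ 2 + fsin mu (L - a) ^+ 2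
  + 2 * (cosh (lambda * L) * (fsin (mu - h) a * fsin mu (L - a))).

(* For positive [fsin] values, vanishing of this function is equivalent to
   [joint_fsin > 0] together with the classical discriminant equation
   [trace = 2 cosh (lambda L)]; the square root builds in the sign condition,
   which is what makes the Floquet solution positive. *)
Definition floquet_defect h a L lambda mu : R :=
  joint_fsin h a L mu - Num.sqrt (floquet_disc h a L lambda mu).

(** Half a wave fills the first piece, so [joint_fsin] reduces to [- fsin mu (L - a)], which is
    negative because [mu > 0]. *)
Lemma floquet_defect_left h a L lambda : 0 < a < L -> 0 < h - (pi / a) ^+ 2 ->
  floquet_defect h a L lambda (h - (pi / a) ^+ 2) < 0.
Proof.
move=> /andP[a0 aL] mu0; rewrite /floquet_defect /joint_fsin.
have -> : h - (pi / a) ^+ 2 - h = - (pi / a) ^+ 2 by ring.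
rewrite fsin_pi // fcos_pi // mulr0 addr0 mulN1r.
have : 0 < fsin (h - (pi / a) ^+ 2) (L - a).
  apply: (fsin_gt0 (a := L - a)); first by rewrite subr_gt0 aL lexx.
  by have := sqr_ge0 (pi / (L - a)); lra.
by have := sqrtr_ge0 (floquet_disc h a L lambda (h - (pi / a) ^+ 2)); lra.
Qed.

Lemma fsin_gt0_of_ge h a L mu : 0 < a < L -> 0 < h - (pi / a) ^+ 2 ->
  h - (pi / a) ^+ 2 < mu -> 0 < fsin (mu - h) a /\ 0 < fsin mu (L - a).
Proof.
move=> /andP[a0 aL] mu0 mul; split.
  by apply: (fsin_gt0 (a := a)); [rewrite a0 lexx|lra].
apply: (fsin_gt0 (a := L - a)); first by rewrite subr_gt0 aL lexx.
by have := sqr_ge0 (pi / (L - a)); lra.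
Qed.

(** Here both pieces are hyperbolic, with rates [lambda] and [p >= lambda], so the monodromy matrix
    has trace at least [2 cosh (lambda L)]. *)
Lemma floquet_defect_right h a L lambda : 0 < lambda -> 0 < a < L ->
  0 < h - (pi / a) ^+ 2 ->
  0 <= floquet_defect h a L lambda (lambda ^+ 2 + h).
Proof.
move=> lambda0 aL mu0; rewrite /floquet_defect subr_ge0.
have h0 : 0 < h by have := sqr_ge0 (pi / a); lra.
have l20 : 0 < lambda ^+ 2 by rewrite exprn_gt0.
have [|S1 S2] := fsin_gt0_of_ge (mu := lambda ^+ 2 + h) aL mu0.
  by have := sqr_ge0 (pi / a); lra.
case/andP: aL => a0 aL.
pose p := Num.sqrt (lambda ^+ 2 + h).
have p2 : p ^+ 2 = lambda ^+ 2 + h by rewrite sqr_sqrtr //; lra.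
have p0 : 0 < p by rewrite sqrtr_gt0; lra.
have lp : lambda <= p.
  by rewrite -(@ler_pXn2r _ 2%N) ?nnegrE ?p2 ?(ltW p0) ?(ltW lambda0) //; lra.
have sl : Num.sqrt (lambda ^+ 2) = lambda by rewrite sqrtr_sqr gtr0_norm.
have I1 := fcos2Bfsin2 (lambda ^+ 2 + h - h) a.
have I2 := fcos2Bfsin2 (lambda ^+ 2 + h) (L - a).
have C1 : 0 < fcos (lambda ^+ 2 + h - h) a.
  by rewrite addrK fcos_ge0E ?sqr_ge0 // cosh_gt0.
have C2 : 0 < fcos (lambda ^+ 2 + h) (L - a).
  by rewrite fcos_ge0E ?cosh_gt0 //; lra.
(* The right-hand side is the trace. Replacing [lambda ^+ 2 + p ^+ 2] by the smaller [2 lambda p]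
   turns it into [2 cosh (lambda a + p (L - a))] by the addition formula. *)
have key : 2 * cosh (lambda * L) <=
    2 * (fcos (lambda ^+ 2 + h - h) a * fcos (lambda ^+ 2 + h) (L - a)) +
    (lambda ^+ 2 + (lambda ^+ 2 + h)) *
    (fsin (lambda ^+ 2 + h - h) a * fsin (lambda ^+ 2 + h) (L - a)).
  have pl2 : 2 * (lambda * p) <= lambda ^+ 2 + (lambda ^+ 2 + h).
    by rewrite -p2; have := sqr_ge0 (lambda - p); nra.
  apply: (@le_trans _ _
      (2 * (fcos (lambda ^+ 2 + h - h) a * fcos (lambda ^+ 2 + h) (L - a)) +
      2 * (lambda * p) *
      (fsin (lambda ^+ 2 + h - h) a * fsin (lambda ^+ 2 + h) (L - a)))).
    2: by rewrite lerD2l ler_wpM2r // mulr_ge0 // ltW.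
  rewrite addrK fcos_ge0E ?sqr_ge0 // fsin_gt0E // sl.
  rewrite fcos_ge0E; last by lra.
  rewrite fsin_gt0E; last by lra.
  rewrite -/p.
  have -> : 2 * (cosh (lambda * a) * cosh (p * (L - a))) + 2 * (lambda * p) *
      (lambda^-1 * sinh (lambda * a) * (p^-1 * sinh (p * (L - a)))) =
      2 * cosh (lambda * a + p * (L - a)).
    by rewrite coshD; field; rewrite !gt_eqF.
  rewrite ler_pM2l // ler_cosh //; first by rewrite mulr_ge0 //; lra.
  have : lambda * (L - a) <= p * (L - a) by rewrite ler_wpM2r //; lra.
  by lra.
move: S1 S2 C1 C2 I1 I2 key; rewrite /joint_fsin /floquet_disc.
have q1E : lambda ^+ 2 + h - h = lambda ^+ 2 by ring.
move: (fsin (_ - h) a) (fsin _ (L - a)) (fcos (_ - h) a) (fcos _ (L - a)).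
move=> s1 s2 c1 c2 S1 S2 C1 C2; rewrite q1E => I1 I2 key.
have Q0 : 0 <= c1 * s2 + c2 * s1 by rewrite addr_ge0 // mulr_ge0 // ltW.
rewrite -[leRHS](ger0_norm Q0) -sqrtr_sqr ler_sqrt ?sqr_ge0 //.
have ss : 0 < s1 * s2 by rewrite mulr_gt0.
have := ler_wpM2r (ltW ss) key; rewrite -subr_ge0 => K.
rewrite -subr_ge0.
(* The difference of the squares is [(trace - 2 cosh (lambda L)) s1 s2] up to multiples of the
   Wronskian identities [I1] and [I2]. *)
have -> : (c1 * s2 + c2 * s1) ^+ 2 - (s1 ^+ 2 + s2 ^+ 2 +
    2 * (cosh (lambda * L) * (s1 * s2))) =
    (2 * (c1 * c2) + (lambda ^+ 2 + (lambda ^+ 2 + h)) * (s1 * s2)) * (s1 * s2)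
     - 2 * cosh (lambda * L) * (s1 * s2)
    + (c1 ^+ 2 - lambda ^+ 2 * s1 ^+ 2 - 1) * s2 ^+ 2
    + (c2 ^+ 2 - (lambda ^+ 2 + h) * s2 ^+ 2 - 1) * s1 ^+ 2 by ring.
by rewrite I1 I2 !subrr !mul0r !addr0.
Qed.

Lemma continuous_joint_fsin h a L : continuous (joint_fsin h a L).
Proof.
have csub : continuous (fun mu => mu - h).
  by apply: continuous_sub; [move=> ?; exact: cvg_id|exact: cst_continuous].
have cs : continuous (fun mu => fsin (mu - h) a).
  move=> mu; apply: (continuous_comp (g := fun q => fsin q a) (csub mu)).
  exact: continuous_fsin.
have cc : continuous (fun mu => fcos (mu - h) a).
  move=> mu; apply: (continuous_comp (g := fun q => fcos q a) (csub mu)).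
  exact: continuous_fcos.
exact: (continuous_add (continuous_mul cc (continuous_fsin (x := L - a)))
  (continuous_mul (continuous_fcos (x := L - a)) cs)).
Qed.

(** Joint continuity serves twice: for the intermediate value theorem in [mu], and for the
    closedness of the set of roots [(lambda, mu)]. *)
Lemma continuous_floquet_defect h a L :
  continuous (fun z : R * R => floquet_defect h a L z.1 z.2).
Proof.
have c1 : continuous (fst : R * R -> R) by move=> z; exact: cvg_fst.
have c2 : continuous (snd : R * R -> R) by move=> z; exact: cvg_snd.
have csub : continuous (fun z : R * R => z.2 - h).
  by move=> z; apply: (continuousB (c2 z)); exact: cst_continuous.
have cs1 : continuous (fun z : R * R => fsin (z.2 - h) a).
  move=> z; apply: (continuous_comp (g := fun q => fsin q a) (csub z)).
  exact: continuous_fsin.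
have cs2 : continuous (fun z : R * R => fsin z.2 (L - a)).
  move=> z; apply: (continuous_comp (g := fun q => fsin q (L - a)) (c2 z)).
  exact: continuous_fsin.
have cj : continuous (fun z : R * R => joint_fsin h a L z.2).
  move=> z; apply: (continuous_comp (g := joint_fsin h a L) (c2 z)).
  exact: continuous_joint_fsin.
have cl : continuous (fun z : R * R => z.1 * L).
  by move=> z; apply: (continuousM (c1 z)); exact: cst_continuous.
have cch : continuous (fun z : R * R => cosh (z.1 * L)).
  by move=> z; apply: (continuous_comp (g := @cosh R) (cl z)); exact: continuous_cosh.
have cM (f g : R * R -> R) : continuous f -> continuous g ->
    continuous (fun z => f z * g z).
  by move=> cf cg z; apply: (continuousM (cf z) (cg z)).
have cD (f g : R * R -> R) : continuous f -> continuous g ->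
    continuous (fun z => f z + g z).
  by move=> cf cg z; apply: (continuousD (cf z) (cg z)).
have cdisc : continuous (fun z : R * R => floquet_disc h a L z.1 z.2).
  rewrite /floquet_disc; apply: (cD); first by apply: (cD); apply: (cM).
  apply: (cM); first exact: cst_continuous.
  by apply: (cM) => //; apply: (cM).
move=> z; apply: (continuousB (cj z)).
by apply: (continuous_comp (g := Num.sqrt) (cdisc z)); exact: sqrt_continuous.
Qed.

Lemma exists_floquet_defect_root h a L lambda : 0 < lambda -> 0 < a < L ->
  0 < h - (pi / a) ^+ 2 ->
  exists2 mu, h - (pi / a) ^+ 2 <= mu <= lambda ^+ 2 + h &
    floquet_defect h a L lambda mu = 0.
Proof.
move=> lambda0 aL mu0.
have lr : h - (pi / a) ^+ 2 <= lambda ^+ 2 + h.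
  by have := sqr_ge0 (pi / a); have := sqr_ge0 lambda; lra.
have fl := floquet_defect_left lambda aL mu0.
have fr := floquet_defect_right lambda0 aL mu0.
have cf : continuous (floquet_defect h a L lambda).
  move=> mu; have cp : {for mu, continuous (fun y : R => (lambda, y))}.
    apply: (@cvg_pair _ _ _ _ (nbhs lambda) (nbhs mu)); first exact: cvg_cst.
    exact: cvg_id.
  apply: (continuous_comp
    (g := fun z : R * R => floquet_defect h a L z.1 z.2) cp).
  exact: continuous_floquet_defect.
have [|mu mulr E] := IVT lr (continuous_subspaceT cf) (v := 0).
  by rewrite ge_min le_max (ltW fl) fr orbT.
by exists mu => //; rewrite in_itv in mulr.
Qed.

(** With [dirichlet] pieces of end values [1, u] and [u, rho], continuity and positivity hold by
    construction. Two slope conditions remain; each determines [u], and they are compatible at a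
    root of the defect. *)
Lemma floquet_pieces h a L lambda mu : 0 < a < L -> 0 < h - (pi / a) ^+ 2 ->
  h - (pi / a) ^+ 2 <= mu -> floquet_defect h a L lambda mu = 0 ->
  exists fA gA fB gB : R -> R,
  [/\ forall x : R, is_derive x 1 fA (gA x) /\ is_derive x 1 gA ((mu - h) * fA x),
      forall x : R, is_derive x 1 fB (gB x) /\ is_derive x 1 gB (mu * fB x),
      fA a = fB a /\ gA a = gB a,
      fB L = expR (lambda * L) * fA 0 /\ gB L = expR (lambda * L) * gA 0 &
      (forall x, 0 <= x <= a -> 0 < fA x) /\ (forall x, a <= x <= L -> 0 < fB x)].
Proof.
move=> aL mu0 muge E.
have mugt : h - (pi / a) ^+ 2 < mu.
  rewrite lt_neqAle muge andbT; apply/eqP => muE.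
  by have := floquet_defect_left lambda aL mu0; rewrite muE E ltxx.
have [S1 S2] := fsin_gt0_of_ge aL mu0 mugt.
case/andP: aL => a0 aL.
set rho := expR (lambda * L); have rho0 : 0 < rho by exact: expR_gt0.
have coshE : 2 * cosh (lambda * L) = rho + rho^-1.
  by rewrite /cosh -expRN /rho; field.
pose Q := joint_fsin h a L mu.
have D0 : 0 < floquet_disc h a L lambda mu.
  have ch : 0 < cosh (lambda * L) by exact: cosh_gt0.
  have := mulr_gt0 ch (mulr_gt0 S1 S2).
  have := exprn_gt0 2 S1; have := exprn_gt0 2 S2; rewrite /floquet_disc; lra.
have QE : Q = Num.sqrt (floquet_disc h a L lambda mu).
  by move/eqP: E; rewrite subr_eq0 => /eqP.
have Q0 : 0 < Q by rewrite QE sqrtr_gt0.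
have Q2 : rho * Q ^+ 2 = (fsin mu (L - a) + rho * fsin (mu - h) a) *
    (rho * fsin mu (L - a) + fsin (mu - h) a).
  rewrite QE sqr_sqrtr ?(ltW D0) // /floquet_disc mulrA coshE.
  by field; rewrite gt_eqF.
(* The value at [a], forced by matching the two derivatives there. *)
pose u := (fsin mu (L - a) + rho * fsin (mu - h) a) / Q.
have u0 : 0 < u by rewrite divr_gt0 // addr_gt0 // mulr_gt0.
have S1n : fsin (mu - h) a != 0 by rewrite gt_eqF.
have S2n : fsin mu (L - a) != 0 by rewrite gt_eqF.
have Qn : Q != 0 by rewrite gt_eqF.
exists (dirichlet (mu - h) a 1 u), (dirichlet' (mu - h) a 1 u),
  (fun x => dirichlet mu (L - a) u rho (x - a)),
  (fun x => dirichlet' mu (L - a) u rho (x - a)).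
split.
- by move=> x; split; [exact: is_derive_dirichlet|exact: is_derive_dirichlet'].
- move=> x; split; apply: is_derive_shifted_arg.
    exact: is_derive_dirichlet.
  exact: is_derive_dirichlet'.
- split; first by rewrite subrr dirichlet_left // dirichlet_right.
  rewrite /dirichlet' !subrr !fcos0 !subr0 mul1r !mulr1.
  have uQ : u * Q = fsin mu (L - a) + rho * fsin (mu - h) a by rewrite divfK.
  apply/eqP; rewrite -subr_eq0; apply/eqP.
  apply: (@mulIf _ (fsin (mu - h) a * fsin mu (L - a))); first by rewrite mulf_neq0.
  rewrite mul0r.
  transitivity (u * Q - (fsin mu (L - a) + rho * fsin (mu - h) a)).
    by rewrite /Q /joint_fsin; field; rewrite ?S1n ?S2n.
  by rewrite uQ subrr.
- split; first by rewrite dirichlet_left // dirichlet_right // mulr1.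
  rewrite /dirichlet' !subrr !fcos0 !subr0 mul1r !mulr1.
  (* The slope condition between [L] and [0] is this second equation for [u]; [Q2] shows that the
     [u] already chosen satisfies it. *)
  have uQ : u * (rho * fsin mu (L - a) + fsin (mu - h) a) = rho * Q.
    rewrite /u mulrAC -Q2; field; exact: Qn.
  apply/eqP; rewrite -subr_eq0; apply/eqP.
  apply: (@mulIf _ (fsin (mu - h) a * fsin mu (L - a))); first by rewrite mulf_neq0.
  rewrite mul0r.
  transitivity (rho * Q - u * (rho * fsin mu (L - a) + fsin (mu - h) a)).
    by rewrite /Q /joint_fsin; field; rewrite ?S1n ?S2n.
  by rewrite uQ subrr.
- split=> x xa.
    by apply: dirichlet_gt0 => //; lra.
  apply: dirichlet_gt0 => //; [|lra|lra].
  by have := sqr_ge0 (pi / (L - a)); lra.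
Qed.

End FloquetExistence.

(** * Periodic gluing *)

Section PeriodicGluing.
Variable R : realType.
Notation mu := (@lebesgue_measure R).
Implicit Types (f g F G : R -> R) (x y u v w d e a L : R).

(** The Caratheodory slopes of [fl] and [fr] both tend to [d], and each difference quotient of [f]
    at [x] is one of them, as both half-open intervals contain [x]. *)
Lemma is_derive_two_sided f fl fr x d u v : u < x < v ->
  (forall y, u < y <= x -> f y = fl y) ->
  (forall y, x <= y < v -> f y = fr y) ->
  is_derive x 1 fl d -> is_derive x 1 fr d -> is_derive x 1 f d.
Proof.
move=> /andP[ux xv] fE1 fE2 /is_derive1_caratheodory[gl [El cl dl]].
move=> /is_derive1_caratheodory[gr [Er cr dr]].
apply/is_derive1_caratheodory.
exists (fun z => if z == x then d else (f z - f x) / (z - x)).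
split; last by rewrite eqxx.
  move=> z; have [->|zx] := eqVneq z x; first by rewrite !subrr mulr0.
  by rewrite divfK // subr_eq0.
rewrite /prop_for /continuous_at eqxx; apply/cvgrPdist_lt => eps eps0.
have Nl : \forall z \near x, `|d - gl z| < eps.
  by rewrite -dl; move/cvgrPdist_lt : cl; exact.
have Nr : \forall z \near x, `|d - gr z| < eps.
  by rewrite -dr; move/cvgrPdist_lt : cr; exact.
have xin : x \in `]u, v[ by rewrite in_itv /= ux.
have Ne := near_in_itvoo xin.
near=> z.
have zl : `|d - gl z| < eps by near: z.
have zr : `|d - gr z| < eps by near: z.
have : z \in `]u, v[ by near: z.
rewrite in_itv => /andP[/= z1 z2].
have [zx|zx] := eqVneq z x; first by rewrite subrr normr0.
have zx0 : z - x != 0 by rewrite subr_eq0.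
have fxl : f x = fl x by apply: fE1; lra.
have fxr : f x = fr x by apply: fE2; lra.
have [zltx|xltz|zE] := ltgtP z x; last by rewrite zE eqxx in zx.
  have -> : f z = fl z by apply: fE1; lra.
  by rewrite fxl El mulfK.
have -> : f z = fr z by apply: fE2; lra.
by rewrite fxr Er mulfK.
Unshelve. all: by end_near. Qed.

(** A version of [has_L1loc_derivative] on one segment, to be checked piece by piece and
    concatenated. *)
Definition primitive_on F f u v : Prop :=
  mu.-integrable `[u, v] (EFin \o f) /\
  forall x, u <= x <= v -> F x - F u = \int[mu]_(t in `[u, x]) f t.

Lemma primitive_on_cat F f u v w : u <= v <= w ->
  primitive_on F f u v -> primitive_on F f v w -> primitive_on F f u w.
Proof.
move=> /andP[uv vw] [i1 E1] [i2 E2].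
have uwE : `[u, w]%classic = `[u, v] `|` `]v, w].
  by rewrite -itv_bndbnd_setU // bnd_simp.
have i2' : mu.-integrable `]v, w] (EFin \o f).
  by apply: integrableS i2 => //; apply: subset_itvr; rewrite bnd_simp.
have i12 : mu.-integrable `[u, w] (EFin \o f).
  rewrite uwE; move/integrableP: i1 => [m1 l1]; move/integrableP: i2' => [m2 l2].
  have m12 : measurable_fun (`[u, v] `|` `]v, w]) (EFin \o f).
    by apply/measurable_funU.
  apply/integrableP; split=> //.
  rewrite ge0_integral_setU //.
  - by rewrite lte_add_pinfty.
  - exact: measurableT_comp.
  - apply/disj_setPRL => z; rewrite /= !in_itv /= => /andP[vz _] /andP[_ zv].
    by move: (lt_le_trans vz zv); rewrite ltxx.
split=> // x /andP[ux xw].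
have [xv|/ltW vx] := leP x v; first by apply: E1; rewrite ux.
have iux : mu.-integrable `[u, x] (EFin \o f).
  by apply: integrableS i12 => //; apply: subset_itvl; rewrite bnd_simp.
rewrite (Rintegral_itv_cat (v := v)) ?uv // -E1 ?uv ?lexx // -E2 ?vx //.
by rewrite [RHS]addrC subrKA.
Qed.

(** Agreement of [f] with [g] is asked on the open interval only, since a second derivative may jump
    at breakpoints; endpoints do not affect integrals. *)
Lemma primitive_on_smooth F f G g u v : u <= v ->
  (forall x : R, is_derive x 1 G (g x)) -> continuous g ->
  (forall x, u <= x <= v -> F x = G x) -> (forall x, u < x < v -> f x = g x) ->
  primitive_on F f u v.
Proof.
move=> uv dG cg FG fg.
have intg w z : mu.-integrable `[w, z] (EFin \o g).
  apply: continuous_compact_integrable; first exact: segment_compact.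
  exact: continuous_subspaceT.
have mg : measurable_fun setT g by exact: continuous_measurable_fun.
have mfo : measurable_fun `]u, v[ f.
  apply: (eq_measurable_fun g); last exact: measurable_funS mg.
  by move=> z; rewrite inE /= in_itv /= => /fg.
split.
  apply/integrableP; split.
    by apply/measurable_EFinP; exact: measurable_fun_itv_cc mfo.
  have /integrableP[_] := intg u v; apply: le_lt_trans.
  rewrite le_eqVlt; apply/orP; left; apply/eqP.
  apply: (eq_integral_itv_bounded (f := fun z => `|f z|) (g := fun z => `|g z|)).
  - exact: measurableT_comp.
  - by apply: measurableT_comp => //; exact: measurable_funS mg.
  - by move=> z; rewrite in_itv /= => /fg ->.
move=> x /andP[]; rewrite le_eqVlt => /predU1P[<- _|ux xv].
  by rewrite subrr set_itv1 Rintegral_set1.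
rewrite /Rintegral (eq_integral_itv_bounded (g := g)).
- rewrite (continuous_FTC2 ux (F := G)).
  + by rewrite -EFinB /= !FG ?ux ?(ltW ux) ?lexx ?xv ?uv.
  + exact: continuous_subspaceT.
  + have cG := is_derive_continuous dG.
    split; [|exact: cvg_at_right_filter (cG u)|exact: cvg_at_left_filter (cG x)].
    by move=> z _; have [] := dG z.
  + by move=> z _; rewrite derive1E; apply/derive_val.
- by apply: measurable_funS mfo => //; apply: subset_itvl; rewrite bnd_simp.
- exact: measurable_funS mg.
- move=> z; rewrite in_itv /= => /andP[uz zx]; apply: fg.
  by rewrite uz (lt_le_trans zx).
Qed.

(** The segments exhaust the line, so any two points, or any compact set, lie in a single one. *)
Lemma primitive_on_has_L1loc_derivative F f L : 0 < L ->
  (forall n : nat, primitive_on F f (- (n%:R * L)) (n%:R * L)) ->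
  has_L1loc_derivative F f.
Proof.
move=> L0 P.
have bnd M : exists n : nat, M <= n%:R * L.
  exists (Num.bound (`|M| / L)); apply: (le_trans (ler_norm M)).
  by rewrite -ler_pdivrMr // ltW // archi_boundP // divr_ge0 // ltW.
split; last first.
  move=> x y xy; have [n Mn] := bnd (`|x| + `|y|).
  have [intf E] := P n.
  have nx := ler_norm x; have ny := ler_norm y.
  have nx' := ler_normr x (- x); have ny' := ler_norm (- y).
  have nx'' := ler_norm (- x); rewrite normrN in nx'' ny'.
  have x0 := normr_ge0 x; have y0 := normr_ge0 y.
  have /E Ex : - (n%:R * L) <= x <= n%:R * L by lra.
  have ylr : - (n%:R * L) <= y <= n%:R * L by lra.
  have Ey := E y ylr; case/andP: ylr => yl yr.
  have intfy : mu.-integrable `[- (n%:R * L), y] (EFin \o f).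
    by apply: integrableS intf => //; apply: subset_itvl; rewrite bnd_simp.
  have xl : - (n%:R * L) <= x <= y by lra.
  by have := Rintegral_itv_cat xl intfy; rewrite -Ex -Ey; lra.
have mf : measurable_fun setT f.
  have -> : [set: R] = \bigcup_n [set` `[- (n%:R * L), n%:R * L]].
    apply/esym/seteqP; split=> // x _; have [n Mn] := bnd `|x|.
    by exists n => //=; rewrite in_itv /= -ler_norml.
  apply/measurable_fun_bigcup => // n; have [/integrableP[+ _] _] := P n.
  by move/measurable_EFinP.
split=> //; first exact: openT.
move=> K _ cK; have [M [_ bK]] := compact_bounded cK.
have [n Mn] := bnd (M + 1).
have [/integrableP[mfn fn] _] := P n.
apply: le_lt_trans fn; apply: ge0_subset_integral => //.
- exact: compact_measurable.
- by apply/measurable_EFinP; apply: measurableT_comp => //; exact: measurable_funS mf.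
- move=> x Kx; rewrite /= in_itv /= -ler_norml; apply: le_trans Mn.
  by apply: (bK (M + 1)) => //; rewrite ltrDl.
Qed.

(** The offset [L] already belongs to the next cell, where [F 0] is taken; hence the matching
    conditions [F a = G a] and [G L = F 0] below. *)
Definition cell_glue a L F G x : R :=
  let r := x - (Num.floor (x / L))%:~R * L in if r <= a then F r else G r.

Lemma cell_glueE a L F G (n : int) x : 0 < L ->
  n%:~R * L <= x < (n + 1)%:~R * L ->
  cell_glue a L F G x =
    if x - n%:~R * L <= a then F (x - n%:~R * L) else G (x - n%:~R * L).
Proof.
by move=> L0 xn; rewrite /cell_glue (@floor_def _ _ n) // ler_pdivlMr // ltr_pdivrMr.
Qed.

Lemma cell_glue_periodic a L F G : 0 < L -> periodic (cell_glue a L F G) L.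
Proof.
move=> L0 x; have Ln0 : L != 0 by rewrite gt_eqF.
rewrite /cell_glue mulrDl divff // floorDrz // floor1 intrD mulrDl mul1r.
by rewrite opprD addrACA subrr addr0.
Qed.

Lemma cell_glue_onA a L F G (n : int) x : 0 < a < L ->
  n%:~R * L <= x <= n%:~R * L + a -> cell_glue a L F G x = F (x - n%:~R * L).
Proof.
move=> aL xn; rewrite (@cell_glueE _ _ _ _ n) ?intrD ?mulrDl; [|lra|lra].
by rewrite ifT //; lra.
Qed.

Lemma cell_glue_onB a L F G (n : int) x : 0 < a < L -> F a = G a -> G L = F 0 ->
  n%:~R * L + a <= x <= n%:~R * L + L -> cell_glue a L F G x = G (x - n%:~R * L).
Proof.
move=> aL Fa GL /andP[nx xn]; have [xL|xL] := eqVneq x (n%:~R * L + L).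
  rewrite (@cell_glue_onA _ _ _ _ (n + 1)) ?intrD ?mulrDl ?mul1r //; last by lra.
  by rewrite xL subrr [_ + L]addrC addrK GL.
rewrite (@cell_glueE _ _ _ _ n) ?intrD ?mulrDl; [|lra|lra].
have [xa|xa] := eqVneq x (n%:~R * L + a).
  by rewrite xa [_ + a]addrC addrK lexx.
by rewrite ifF //; apply/negbTE; rewrite -ltNge; lra.
Qed.

Lemma is_derive_cell_glue a L F (F1 : R -> R) G (G1 : R -> R) : 0 < a < L ->
  (forall x, is_derive x 1 F (F1 x)) -> (forall x, is_derive x 1 G (G1 x)) ->
  F a = G a -> G L = F 0 -> F1 a = G1 a -> G1 L = F1 0 ->
  forall x, is_derive x 1 (cell_glue a L F G) (cell_glue a L F1 G1 x).
Proof.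
move=> aL dF dG Fa GL F1a G1L x; have L0 : 0 < L by lra.
pose n := Num.floor (x / L); pose r := x - n%:~R * L.
have /andP[] := floor_itv (x / L); rewrite -/n ler_pdivlMr // ltr_pdivrMr //.
rewrite intrD mulrDl mul1r => nx xn.
have dFn (m : int) := is_derive_shifted_arg (dF (x - m%:~R * L)).
have dGn (m : int) := is_derive_shifted_arg (dG (x - m%:~R * L)).
have [u [fl [ux glE dl]]] : exists u fl, [/\ u < x,
    forall y, u < y <= x -> cell_glue a L F G y = fl y &
    is_derive x 1 fl (cell_glue a L F1 G1 x)].
  move: nx; rewrite le_eqVlt => /predU1P[xE|ngt]; last first.
    have [xa|ax] := leP x (n%:~R * L + a).
      exists (n%:~R * L), (fun y => F (y - n%:~R * L)); split=> //.
        by move=> y yx; apply: cell_glue_onA => //; lra.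
      by rewrite (@cell_glue_onA _ _ _ _ n) //; lra.
    exists (n%:~R * L + a), (fun y => G (y - n%:~R * L)); split=> //.
      by move=> y yx; apply: cell_glue_onB => //; lra.
    by rewrite (@cell_glue_onB _ _ _ _ n) //; lra.
  (* Here [x] is the left end of its cell, so just to its left the function is given by [G] on the
     previous cell. *)
  have nE : (n - 1)%:~R * L = x - L by rewrite intrB mulrBl mul1r xE.
  exists ((n - 1)%:~R * L + a), (fun y => G (y - (n - 1)%:~R * L)); split.
  - by rewrite nE; lra.
  - move=> y; rewrite nE => yx; rewrite -nE.
    by apply: cell_glue_onB => //; rewrite nE; lra.
  - by rewrite (@cell_glue_onB _ _ _ _ (n - 1)) // nE; lra.
have [v [fr [xv grE dr]]] : exists v fr, [/\ x < v,
    forall y, x <= y < v -> cell_glue a L F G y = fr y &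
    is_derive x 1 fr (cell_glue a L F1 G1 x)].
  have [xa|ax] := ltP x (n%:~R * L + a).
    exists (n%:~R * L + a), (fun y => F (y - n%:~R * L)); split=> //.
      by move=> y yx; apply: cell_glue_onA => //; lra.
    by rewrite (@cell_glue_onA _ _ _ _ n) //; lra.
  exists (n%:~R * L + L), (fun y => G (y - n%:~R * L)); split=> //.
    by move=> y yx; apply: cell_glue_onB => //; lra.
  by rewrite (@cell_glue_onB _ _ _ _ n) //; lra.
by apply: (is_derive_two_sided (u := u) (v := v) _ glE grE) => //; rewrite ux.
Qed.

(** Each cell concatenates two smooth pieces, and [[- n L, n L]] concatenates [2 n] cells starting
    from cell [- n]. *)
Lemma cell_glue_has_L1loc_derivative a L (F1 F2 G1 G2 h2 : R -> R) : 0 < a < L ->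
  (forall x, is_derive x 1 F1 (F2 x)) -> (forall x, is_derive x 1 G1 (G2 x)) ->
  continuous F2 -> continuous G2 -> F1 a = G1 a -> G1 L = F1 0 ->
  (forall (n : int) x, n%:~R * L < x < n%:~R * L + a ->
     h2 x = F2 (x - n%:~R * L)) ->
  (forall (n : int) x, n%:~R * L + a < x < n%:~R * L + L ->
     h2 x = G2 (x - n%:~R * L)) ->
  has_L1loc_derivative (cell_glue a L F1 G1) h2.
Proof.
move=> aL dF dG cF cG Fa GL hF hG; have L0 : 0 < L by lra.
have cshift (H : R -> R) (c : R) : continuous H -> continuous (fun y : R => H (y - c)).
  have csub : continuous (fun y : R => y - c).
    by apply: continuous_sub; [move=> ?; exact: cvg_id|exact: cst_continuous].
  by move=> cH x; apply: (continuous_comp (g := H) (csub x)); exact: cH.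
have cell (n : int) :
    primitive_on (cell_glue a L F1 G1) h2 (n%:~R * L) (n%:~R * L + L).
  apply: (primitive_on_cat (v := n%:~R * L + a)); first by lra.
    apply: (primitive_on_smooth (G := fun y => F1 (y - n%:~R * L))
      (g := fun y => F2 (y - n%:~R * L))); first by lra.
    - by move=> x; exact: is_derive_shifted_arg.
    - exact: cshift.
    - by move=> x; exact: cell_glue_onA.
    - exact: hF.
  apply: (primitive_on_smooth (G := fun y => G1 (y - n%:~R * L))
    (g := fun y => G2 (y - n%:~R * L))); first by lra.
  - by move=> x; exact: is_derive_shifted_arg.
  - exact: cshift.
  - by move=> x; exact: cell_glue_onB.
  - exact: hG.
have cells (m : int) (n : nat) :
    primitive_on (cell_glue a L F1 G1) h2 (m%:~R * L) ((m + n%:Z)%:~R * L).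
  elim: n => [|n IHn].
    rewrite addr0; have [intf _] := cell m; split.
      apply: integrableS intf => //; apply: subset_itvl; rewrite bnd_simp; lra.
    move=> x xm; have -> : x = m%:~R * L by lra.
    by rewrite subrr set_itv1 Rintegral_set1.
  apply: primitive_on_cat IHn _.
    by rewrite -addn1 PoszD addrA !intrD !mulrDl mul1r; have := ler0n R n; nra.
  rewrite -addn1 PoszD addrA [in X in primitive_on _ _ _ X]intrD mulrDl mul1r.
  exact: cell.
apply: (primitive_on_has_L1loc_derivative L0) => n.
have := cells (- n%:Z) (n + n)%N.
by rewrite PoszD addKr intrN mulNr.
Qed.

End PeriodicGluing.

(** * The step function *)

Section StepFunction.
Variable R : realType.
Implicit Types (beta p t L x y : R).

Definition step_height beta p t : R := beta `^ p^-1 * t `^ (- p^-1).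

Lemma step_profile_on beta p t (n : int) y : t <= 1 ->
  n%:~R < y < n%:~R + t -> step_profile beta p t y = step_height beta p t.
Proof.
move=> t1 /andP[ny yn]; rewrite /step_profile /step_height; congr (_ * _).
rewrite -(@fsbig_widen _ _ _ _ [set n]) //.
  rewrite fsbig_set1 indicE mem_set ?mulr1 //=.
  by rewrite in_itv /= (ltW ny) (ltW yn).
(* As [t <= 1] and [y] is strictly inside its interval, no other closed interval reaches [y]. *)
move=> k [_ /= kn]; rewrite indicE memNset ?mulr0 //= in_itv /= => /andP[ky yk].
have /eqP := kn; rewrite neq_lt => /orP[].
  rewrite -lezD1 -(ler_int R) intrD; lra.
rewrite -lezD1 -(ler_int R) intrD; lra.
Qed.

Lemma step_profile_off beta p t (n : int) y :
  n%:~R + t < y < n%:~R + 1 -> step_profile beta p t y = 0.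
Proof.
move=> /andP[ny yn]; rewrite /step_profile fsbig1 ?mulr0 // => k _.
rewrite indicE memNset ?mulr0 //= in_itv /= => /andP[ky yk].
have [] := leP k n; first by rewrite -(ler_int R); lra.
by rewrite -lezD1 -(ler_int R) intrD; lra.
Qed.

Lemma step_function_on beta p t L (n : int) x : 0 < L -> t <= 1 ->
  n%:~R * L < x < n%:~R * L + t * L ->
  step_function beta p t L x = step_height beta p t.
Proof.
move=> L0 t1 xn; apply: (@step_profile_on _ _ _ n) => //.
by rewrite ltr_pdivlMr // ltr_pdivrMr // mulrDl.
Qed.

Lemma step_function_off beta p t L (n : int) x : 0 < L ->
  n%:~R * L + t * L < x < n%:~R * L + L -> step_function beta p t L x = 0.
Proof.
move=> L0 xn; apply: (@step_profile_off _ _ _ n).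
by rewrite ltr_pdivlMr // ltr_pdivrMr // !mulrDl mul1r.
Qed.

Lemma step_height_gt0 beta p t : 0 < beta -> 0 < t -> 0 < step_height beta p t.
Proof. by move=> beta0 t0; rewrite mulr_gt0 // powR_gt0. Qed.

Lemma step_height_le beta p t s : 0 < p -> 0 < s -> s <= t ->
  step_height beta p t <= step_height beta p s.
Proof.
move=> p0 s0 st; have t0 : 0 < t by lra.
rewrite ler_wpM2l ?powR_ge0 // !powRN lef_pV2 ?posrE ?powR_gt0 //.
by apply: ge0_ler_powR; rewrite ?nnegrE ?invr_ge0 //; lra.
Qed.

Lemma step_height_unbounded beta p M : 0 < beta -> 0 < p -> 0 < M ->
  exists2 s, 0 < s & step_height beta p s = M.
Proof.
move=> beta0 p0 M0; have b0 : 0 < beta `^ p^-1 by rewrite powR_gt0.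
(* Obtained by solving [beta^(1/p) s^(-1/p) = M] for [s]; it may exceed 1. *)
exists ((beta `^ p^-1 / M) `^ p); first by rewrite powR_gt0 // divr_gt0.
rewrite /step_height powRN -powRrM divff ?gt_eqF // powRr1; last first.
  by rewrite divr_ge0 // ltW.
by rewrite invf_div mulrC divfK // gt_eqF.
Qed.

End StepFunction.

(** * Principal eigenvalues and the minimal speed *)

Section PrincipalEigenvalue.
Variable R : realType.
Implicit Types (L lambda mu h a k : R) (b : R -> R).

(** The factor [exp (- lambda x)] absorbs the multiplier, so the two positive pieces then agree in
    value and slope at [a] and across the period, and glue to a periodic eigenfunction. *)
Lemma floquet_defect_root_principal L lambda b h a mu :
  0 < a < L -> 0 < h - (pi / a) ^+ 2 -> h - (pi / a) ^+ 2 <= mu ->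
  (forall (n : int) x, n%:~R * L < x < n%:~R * L + a -> b x = h) ->
  (forall (n : int) x, n%:~R * L + a < x < n%:~R * L + L -> b x = 0) ->
  floquet_defect h a L lambda mu = 0 ->
  is_principal_eigenvalue L lambda b (- mu).
Proof.
move=> aL mu0 muge bh b0 E; have L0 : 0 < L by lra.
have [fA [gA [fB [gB [dA dB [fa ga] [fL gL] [A0 B0]]]]]] :=
  floquet_pieces aL mu0 muge E.
pose e x := expR (- lambda * x).
have de := is_derive_expR_scale (- lambda).
have e0 x : 0 < e x by exact: expR_gt0.
(* [A], [A1], [A2] are [psi], [psi'], [psi''] on the first piece, and [B], [B1], [B2] on the second;
   [A2] and [B2] are written through the equation. *)
pose A x := e x * fA x; pose A1 x := e x * (gA x - lambda * fA x).
pose A2 x := - (2 * lambda) * A1 x - (h + lambda ^+ 2 - mu) * A x.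
pose B x := e x * fB x; pose B1 x := e x * (gB x - lambda * fB x).
pose B2 x := - (2 * lambda) * B1 x - (lambda ^+ 2 - mu) * B x.
have dAA1 (x : R) : is_derive x 1 A (A1 x).
  apply: (is_derive_cast (is_derive_mul (de x) (dA x).1)).
  by rewrite /A1 /e; ring.
have dA1A2 (x : R) : is_derive x 1 A1 (A2 x).
  apply: (is_derive_cast (is_derive_mul (de x)
    (is_derive_sub (dA x).2 (is_derive_scale lambda (dA x).1)))).
  by rewrite /A2 /A1 /A /e; ring.
have dBB1 (x : R) : is_derive x 1 B (B1 x).
  apply: (is_derive_cast (is_derive_mul (de x) (dB x).1)).
  by rewrite /B1 /e; ring.
have dB1B2 (x : R) : is_derive x 1 B1 (B2 x).
  apply: (is_derive_cast (is_derive_mul (de x)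
    (is_derive_sub (dB x).2 (is_derive_scale lambda (dB x).1)))).
  by rewrite /B2 /B1 /B /e; ring.
have cA2 : continuous A2.
  apply: continuous_sub; apply: continuous_scale; exact: is_derive_continuous.
have cB2 : continuous B2.
  apply: continuous_sub; apply: continuous_scale; exact: is_derive_continuous.
have Aa : A a = B a by rewrite /A /B fa.
have A1a : A1 a = B1 a by rewrite /A1 /B1 fa ga.
have eL : e L * expR (lambda * L) = 1.
  by rewrite /e -expRD mulNr addNr expR0.
have eO : e 0 = 1 by rewrite /e mulr0 expR0.
have BL : B L = A 0 by rewrite /A /B fL mulrA eL eO.
have B1L : B1 L = A1 0.
  by rewrite /A1 /B1 fL gL mulrCA -mulrBr mulrA eL eO.
pose psi := cell_glue a L A B; pose psi1 := cell_glue a L A1 B1.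
have dpsi := is_derive_cell_glue aL dAA1 dBB1 Aa BL A1a B1L.
have psiE : derive1 psi = psi1.
  by apply/funext => x; rewrite derive1E; apply/derive_val; exact: dpsi.
exists psi; split.
- exact: cell_glue_periodic.
- move=> x; have /andP[] := floor_itv (x / L).
  rewrite ler_pdivlMr // ltr_pdivrMr // => nx xn.
  rewrite /psi (@cell_glueE _ _ _ _ _ (Num.floor (x / L))) ?nx //.
  move: xn; rewrite intrD mulrDl mul1r => xn.
  case: ifPn => [xa|]; first by rewrite mulr_gt0 // A0 //; lra.
  by rewrite -ltNge => ax; rewrite mulr_gt0 // B0 //; lra.
- split; first by move=> x; have [] := dpsi x.
  (* Reading the second derivative off the equation makes the equation hold everywhere, breakpoints
     included. *)
  exists (fun x => - (2 * lambda) * psi1 x - (b x + lambda ^+ 2 - mu) * psi x).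
  rewrite psiE; split; last first.
    apply: aeW => x; rewrite /=; ring.
  apply: (cell_glue_has_L1loc_derivative aL dA1A2 dB1B2 cA2 cB2 A1a B1L) => n x xn.
    by rewrite (bh n) // /psi /psi1 !(@cell_glue_onA _ _ _ _ _ n) //; lra.
  rewrite (b0 n) // /psi /psi1 !(@cell_glue_onB _ _ _ _ _ n) ?add0r //; lra.
Qed.

Lemma principal_eigenvalue_unique L lambda b h a k1 k2 :
  0 < lambda -> 0 < a <= L ->
  (forall x, 0 < x < a -> b x = h) -> (forall x, a < x < L -> b x = 0) ->
  is_principal_eigenvalue L lambda b k1 -> is_principal_eigenvalue L lambda b k2 ->
  k1 = k2.
Proof.
move=> lambda0 aL bh b0 /eigen_floquet/(_ bh b0)[f1 [g1 F1]].
move=> /eigen_floquet/(_ bh b0)[f2 [g2 F2]].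
have [k12|k21|//] := ltgtP k1 k2.
  by case: (floquet_wronskian lambda0 aL _ F1 F2); rewrite ltrN2.
by case: (floquet_wronskian lambda0 aL _ F2 F1); rewrite ltrN2.
Qed.

(** The value at [lambda = 1] bounds the minimum. When no eigenvalue or no minimum exists, [get]
    returns 0, which respects the bound as [0 <= h]. *)
Lemma minimal_speed_le L b h a : 0 < a <= L -> 0 <= h ->
  (forall x, 0 < x < a -> b x = h) -> (forall x, a < x < L -> b x = 0) ->
  minimal_speed L b <= 1 + h.
Proof.
move=> aL h0 bh b0.
have pe : - principal_eigenvalue L 1 b / 1 <= 1 + h.
  rewrite divr1 /principal_eigenvalue.
  have [[k pk]|npk] := pselect (exists k, is_principal_eigenvalue L 1 b k).
    have := getPex (ex_intro _ k pk :
      exists k, [set k | is_principal_eigenvalue L 1 b k] k).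
    move=> /eigen_floquet/(_ bh b0)[f [g F]].
    by have := floquet_upper_bound aL h0 F; rewrite expr1n.
  rewrite getPN; last by move=> k pk; apply: npk; exists k.
  by rewrite oppr0; lra.
rewrite /minimal_speed /set_min; set S := [set _ | _ in _].
have [[c Sc]|nS] := pselect (exists c, (S `&` lbound S) c).
  have [_ lb] := getPex (ex_intro _ c Sc).
  by apply: le_trans pe; apply: lb; exists 1 => //=.
rewrite getPN; last by move=> c Sc; apply: nS; exists c.
by apply: addr_ge0.
Qed.

Lemma minimal_speed_ge L b h a M : 0 < a < L -> 0 < h - (pi / a) ^+ 2 ->
  (forall (n : int) x, n%:~R * L < x < n%:~R * L + a -> b x = h) ->
  (forall (n : int) x, n%:~R * L + a < x < n%:~R * L + L -> b x = 0) ->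
  0 <= M -> M ^+ 2 <= h - (pi / a) ^+ 2 -> M <= minimal_speed L b.
Proof.
move=> aL mu0 bh b0 M0 M2.
set ml := h - (pi / a) ^+ 2 in mu0 M2.
have h0 : 0 < h by rewrite /ml in mu0; have := sqr_ge0 (pi / a); lra.
have aL' : 0 < a <= L by case/andP: aL => -> /ltW ->.
have bh0 x : 0 < x < a -> b x = h by move=> xa; apply: (bh 0); rewrite mul0r add0r.
have b00 x : a < x < L -> b x = 0 by move=> xa; apply: (b0 0); rewrite mul0r !add0r.
(* By uniqueness, the eigenvalue picked by [get] is the one that the root provides. *)
have rootE lambda mu : 0 < lambda -> ml <= mu -> floquet_defect h a L lambda mu = 0 ->
    - principal_eigenvalue L lambda b = mu.
  move=> lambda0 mlmu E; have pm := floquet_defect_root_principal aL mu0 mlmu bh b0 E.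
  rewrite -[RHS]opprK; congr (- _).
  apply: (principal_eigenvalue_unique lambda0 aL' bh0 b00 _ pm).
  exact: (getPex (ex_intro _ _ pm :
    exists k, [set k | is_principal_eigenvalue L lambda b k] k)).
have bounds lambda mu : 0 < lambda -> ml <= mu -> floquet_defect h a L lambda mu = 0 ->
    lambda ^+ 2 <= mu.
  move=> lambda0 mlmu /(floquet_defect_root_principal aL mu0 mlmu bh b0).
  move=> /eigen_floquet/(_ bh0 b00)[f [g F]].
  have := floquet_lower_bound aL' (ltW h0) F; by rewrite opprK.
have roots lambda (lambda0 : 0 < lambda) := exists_floquet_defect_root lambda0 aL mu0.
set S := [set - principal_eigenvalue L lambda b / lambda
          | lambda in [set lambda : R | 0 < lambda]].
(* [mu / lambda] exceeds its value [c0] at [lambda = 1] as soon as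
   [lambda < ml / c0] or [lambda > c0]. *)
have [c Sc] : exists c, (S `&` lbound S) c.
  have [c0 /andP[mlc0 c0h] E0] := roots 1 ltr01; rewrite -/ml in mlc0.
  have c01 : 1 <= c0 by have := bounds 1 c0 ltr01 mlc0 E0; rewrite expr1n.
  have c0gt : 0 < c0 by lra.
  have l10 : 0 < ml / c0 by rewrite divr_gt0.
  have l11 : ml / c0 <= 1 by rewrite ler_pdivrMr // mul1r.
  (* Roots over this range of [lambda] can be taken with [mu <= lambda ^+ 2 + h <= c0 ^+ 2 + h], so
     a compact part of the root set suffices for the minimum. *)
  pose K := ([set` `[ml / c0, c0]] `*` [set` `[ml, c0 ^+ 2 + h]]) `&`
    ((fun z : R * R => floquet_defect h a L z.1 z.2) @^-1` [set 0]).
  have cK : compact K.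
    apply: compact_closedI.
      by apply: compact_setX; exact: segment_compact.
    apply: closed_comp; last exact: closed_eq.
    by move=> z _; exact: continuous_floquet_defect.
  have K1 : K (1, c0).
    split=> //=; rewrite !in_itv /= l11 c01 mlc0; split=> //.
    have c0sq : c0 <= c0 ^+ 2 by rewrite expr2 ler_peMl //; lra.
    by lra.
  have cf : {within K, continuous (fun z : R * R => z.2 / z.1)}.
    apply: continuous_in_subspaceT => z /[!inE] -[[/= + _] _].
    rewrite in_itv /= => /andP[z1 _].
    have z10 : z.1 != 0 by rewrite gt_eqF //; lra.
    have c1 : {for z, continuous (fst : R * R -> R)} by exact: cvg_fst.
    have c2 : {for z, continuous (snd : R * R -> R)} by exact: cvg_snd.
    by apply: (continuousM c2 (continuousV z10 c1)).
  have [[l m] + Kmin] := compact_EVT_min (ex_intro _ _ K1) cK cf.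
  rewrite inE => -[[/=]]; rewrite !in_itv /= => /andP[l1 l2] /andP[m1 m2] Elm.
  have l0 : 0 < l by lra.
  exists (m / l); split; first by exists l => //; rewrite (rootE _ m).
  move=> _ [lambda /= lambda0 <-].
  have [mu /andP[mlmu muh] E] := roots lambda lambda0; rewrite -/ml in mlmu.
  rewrite (rootE _ mu) //.
  have lec0 : m / l <= c0.
    have := Kmin (1, c0); rewrite inE => /(_ K1) /=; by rewrite divr1.
  have [lam1|lam1] := ltP lambda (ml / c0).
    apply: (le_trans lec0); rewrite ler_pdivlMr //; apply: le_trans mlmu.
    by rewrite mulrC -ler_pdivlMr // ltW.
  have [lam2|lam2] := ltP c0 lambda.
    apply: (le_trans lec0); rewrite ler_pdivlMr //.
    apply: le_trans (bounds _ _ lambda0 mlmu E).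
    by rewrite expr2 ler_wpM2r ?ltW.
  have := Kmin (lambda, mu); rewrite inE; apply.
  split=> //=; rewrite !in_itv /= lam1 lam2 mlmu; split=> //.
  apply: (le_trans muh); rewrite lerD2r ler_sqr ?nnegrE //; lra.
have [[lambda /= lambda0 cE] _] : (S `&` lbound S) (minimal_speed L b).
  exact: (getPex (ex_intro _ c Sc)).
have [mu /andP[mlmu muh] E] := roots lambda lambda0; rewrite -/ml in mlmu.
rewrite -cE (rootE _ mu) //.
have lm := bounds _ _ lambda0 mlmu E.
have mu_gt0 : 0 < mu by lra.
(* After squaring: [mu ^+ 2 / lambda ^+ 2 >= mu >= ml >= M ^+ 2], by [lambda ^+ 2 <= mu]. *)
rewrite -(@ler_pXn2r _ 2%N) ?nnegrE // ?divr_ge0 ?(ltW mu_gt0) ?(ltW lambda0) //.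
apply: (le_trans M2); apply: (le_trans mlmu).
rewrite expr_div_n ler_pdivlMr ?exprn_gt0 // expr2 ler_pM2l //.
Qed.

End PrincipalEigenvalue.

(** * Minimal speeds of step functions *)

Section StepSpeed.
Variable R : realType.
Implicit Types (beta p t L M : R).

Lemma minimal_speed_step_le beta p t L : 0 < beta -> 0 < L -> 0 < t <= 1 ->
  minimal_speed L (step_function beta p t L) <= 1 + step_height beta p t.
Proof.
move=> beta0 L0 /andP[t0 t1]; apply: (minimal_speed_le (a := t * L)).
- by rewrite mulr_gt0 //= ler_piMl // ltW.
- by rewrite ltW // step_height_gt0.
- by move=> x xt; apply: (@step_function_on _ _ _ _ _ 0); rewrite ?mul0r ?add0r.
- by move=> x xt; apply: (@step_function_off _ _ _ _ _ 0); rewrite ?mul0r ?add0r.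
Qed.

Lemma minimal_speed_step_unbounded beta p M : 0 < beta -> 0 < p -> 0 <= M ->
  exists2 t, 0 < t <= 1 &
    \forall L \near +oo, M <= minimal_speed L (step_function beta p t L).
Proof.
move=> beta0 p0 M0.
have M20 := sqr_ge0 M.
(* The extra 2 pays for the loss [(pi / (t L)) ^+ 2 <= 1] at large [L] and keeps the difference
   positive even when [M = 0]. *)
have [|s s0 sE] := @step_height_unbounded R beta p (M ^+ 2 + 2) beta0 p0; first by lra.
(* The cut at one half ensures [t < 1], so that the zero piece is nonempty; decreasing [s] only
   raises the step. *)
pose t := Num.min s 2^-1.
have t0 : 0 < t by rewrite lt_min s0 invr_gt0 ltr0n.
have t1 : t < 1 by rewrite gt_min; apply/orP; right; lra.
have hM : M ^+ 2 + 2 <= step_height beta p t.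
  by rewrite -sE step_height_le // ge_min lexx.
exists t; first by rewrite t0 ltW.
near=> L.
have LE : pi / t <= L by near: L; apply: nbhs_pinfty_ge; exact: num_real.
have L0 : 0 < L by apply: lt_le_trans LE; rewrite divr_gt0 // pi_gt0.
have tL0 : 0 < t * L by exact: mulr_gt0.
have q1 : (pi / (t * L)) ^+ 2 <= 1.
  rewrite exprn_ile1 ?divr_ge0 ?pi_ge0 ?(ltW tL0) //.
  by rewrite ler_pdivrMr // mul1r mulrC -ler_pdivrMr.
apply: (minimal_speed_ge (h := step_height beta p t) (a := t * L)) => //.
- by rewrite mulr_gt0 //= gtr_pMl.
- by lra.
- by move=> n x; apply: step_function_on => //; exact: ltW.
- by move=> n x; exact: step_function_off.
- by lra.
Unshelve. all: by end_near. Qed.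

End StepSpeed.

Unset Implicit Arguments.

Theorem theorem2p11 (R : realType) (beta p : R) (hbeta : 0 < beta) (hp : 1 < p)
  (theta : R -> R)
  (htheta : forall L : R, 0 < L -> 0 < theta L <= 1)
  (hmax : forall L : R, 0 < L -> forall t : R, 0 < t <= 1 ->
     minimal_speed L (step_function beta p t L)
       <= minimal_speed L (step_function beta p (theta L) L)) :
  theta L @[L --> +oo] --> (0 : R) /\
  minimal_speed L (step_function beta p (theta L) L) @[L --> +oo] --> +oo.
Proof.
have p0 : 0 < p by lra.
(* Maximality compares [theta L] with one fixed [t] whose speed is eventually at least [M]. *)
have speedM (M : R) : 0 <= M ->
    \forall L \near +oo, M <= minimal_speed L (step_function beta p (theta L) L).
  move=> M0; have [t t01 tM] := minimal_speed_step_unbounded hbeta p0 M0.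
  near=> L; apply: le_trans (hmax L _ t t01); first by near: L.
  by near: L; apply: nbhs_pinfty_gt; exact: num_real.
split; last first.
  apply/cvgryPge => A; have := speedM `|A| (normr_ge0 A).
  by apply: filterS => L; apply: le_trans; exact: ler_norm.
apply/cvgrPdist_le => e e0.
have he := step_height_gt0 p hbeta e0.
(* If [theta L > e], the step is at most [step_height beta p e] high and the speed at most one more;
   the speed eventually exceeds this by reaching [2 + step_height beta p e]. *)
have he2 : 0 <= 2 + step_height beta p e by lra.
near=> L.
have L0 : 0 < L by near: L; apply: nbhs_pinfty_gt; exact: num_real.
have /andP[th0 th1] := htheta L L0.
rewrite sub0r normrN gtr0_norm // leNgt; apply/negP => eth.
have : 2 + step_height beta p e <= minimal_speed L (step_function beta p (theta L) L).
  by near: L; exact: speedM.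
have := minimal_speed_step_le p hbeta L0 (htheta L L0).
have := step_height_le beta p0 e0 (ltW eth).
lra.
Unshelve. all: by end_near. Qed.
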